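(* For every complex $\alpha$ with $|\alpha|<1$ and every integer $m\ge0$, $$\zeta_1'(-m,\alpha)=\zeta'(-m)+\sum_{k=0}^{m-1}\alpha^{m-k}\binom{m}{k}\Big(\zeta'(-k)-\zeta(-k)\sum_{j=k+1}^{m}\frac1j\Big)+\frac{\alpha^{m+1}}{m+1}\Big(\sum_{j=1}^{m}\frac1j-\gamma\Big)+\sum_{k\ge2}\frac{(-1)^k(k-1)!\,m!}{(m+k)!}\,\zeta(k)\,\alpha^{m+k},$$ where empty sums are zero.
   Context: For complex $\alpha\notin\{0,-1,-2,\dots\}$, $\zeta(s,\alpha)$ denotes the Hurwitz zeta function, defined by $\zeta(s,\alpha)=\sum_{n\ge0}(n+\alpha)^{-s}$ for $\operatorname{Re}s>1$ and by analytic continuation in $s$; $\zeta(s)=\zeta(s,1)$ is the Riemann zeta function. $\zeta_1(s,\alpha)=\zeta(s,1+\alpha)$. A dash denotes differentiation with respect to $s$: $\zeta_1'(-m,\alpha)=\frac{\partial}{\partial s}\zeta_1(s,\alpha)\big|_{s=-m}$ and $\zeta'(-k)=\frac{d}{ds}\zeta(s)\big|_{s=-k}$. $\gamma$ is Euler's constant. *)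

(* Defs.v *)
From Stdlib Require Import Reals ClassicalEpsilon.
From Coquelicot Require Import Coquelicot.

Local Open Scope R_scope.

Definition cexp (z : C) : C := (exp (Re z) * cos (Im z), exp (Re z) * sin (Im z)).

(* Principal argument, with values in (-PI, PI]; irrelevant value at 0. *)
Definition carg (z : C) : R :=
  if Rlt_dec (Im z) 0 then - acos (Re z / Cmod z) else acos (Re z / Cmod z).

Definition clog (z : C) : C := (ln (Cmod z), carg z).

(* Principal branch of z^w, for z <> 0. *)
Definition cpower (z w : C) : C := cexp (w * clog z)%C.

(* Analytic at z0: sum of a convergent power series in z - z0 near z0. *)
Definition analytic_at (f : C -> C) (z0 : C) : Prop :=
  exists (a : nat -> C) (r : R), 0 < r /\
    forall z : C, Cmod (z - z0)%C < r ->
      @is_pseries C_AbsRing C_NormedModule a (z - z0)%C (f z).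

(* Z is, on C \ {1}, the analytic continuation of the Hurwitz series; this
   determines Z s for every s <> 1 and leaves Z at the pole s = 1
   unconstrained. *)
Definition is_hurwitz_zeta (alpha : C) (Z : C -> C) : Prop :=
  (forall s : C, 1 < Re s ->
     @is_series C_AbsRing C_NormedModule
       (fun n : nat => cpower (INR n + alpha)%C (- s)%C) (Z s)) /\
  (forall s : C, s <> RtoC 1 -> analytic_at Z s).

(* Meaningful for alpha outside {0, -1, -2, ...} and s <> 1; epsilon returns
   an arbitrary function where no continuation exists. *)
Definition hurwitz_zeta (s alpha : C) : C :=
  epsilon (inhabits (fun _ : C => RtoC 0)) (is_hurwitz_zeta alpha) s.

Definition zeta (s : C) : C := hurwitz_zeta s (RtoC 1).

Definition zeta1 (s alpha : C) : C := hurwitz_zeta s (1 + alpha)%C.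

(* Differentiation is in s only. *)
Definition zeta' (s : C) : C := C_derive zeta s.

Definition zeta1' (s alpha : C) : C := C_derive (fun t : C => zeta1 t alpha) s.

(* 1/a + ... + 1/b, which is 0 when b < a. *)
Definition inv_sum (a b : nat) : R := sum_n_m (fun j : nat => / INR j) a b.

Definition euler_gamma : R :=
  real (Lim_seq (fun n : nat => inv_sum 1 n - ln (INR n))).

(* f 0 + ... + f (m - 1); Coquelicot's sum_n f n has n + 1 terms. *)
Definition Csum_lt (m : nat) (f : nat -> C) : C :=
  match m with
  | O => RtoC 0
  | S n => sum_n (G := C_AbelianMonoid) f n
  end.

(* Main.v *)
Require Import Defs.
From Stdlib Require Import Reals Factorial Binomial.
From Coquelicot Require Import Coquelicot.
From Stdlib Require Import Lra Lia PeanoNat Classical ClassicalEpsilon.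

(** Write (s)_k for s (s + 1) ... (s + k - 1).  Expanding each
    (n + 1 + alpha)^(-s) by the binomial series gives
      zeta_1(s, alpha) = zeta(s) + sum_{k >= 0} (-alpha)^(k+1) / (k+1)! (s)_k H(s + k + 1)
    with H(s) = (s - 1) zeta(s) entire, so every term is entire and the identity
    continues zeta_1(s, alpha) to all s <> 1.  Differentiating termwise at s = -m
    yields the theorem: the terms k < m involve zeta and zeta' at -(m-1-k), the
    term k = m involves H(1) = 1 and H'(1) = gamma, and for k > m the factor
    (s)_k vanishes at -m, so that only zeta(k - m + 1) survives.

    The continuation of zeta comes from the same expansion with alpha = -1: summing
    (n - 1)^(1-s) - n^(1-s) over n >= 2 shows that h(s) = (s - 1)(zeta(s) - 1) satisfies
      h(s) = 1 - sum_{k >= 1} (s - 1)_k / (k+1)! h(s + k),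
    which extends h one unit to the left at each use and also gives h'(1) = gamma - 1.

    Analyticity of infinite sums needs no Cauchy formula: every function involved
    has, on the discs considered, a power series whose coefficients are summable
    against r^k with an explicit bound, and such bounds add up. *)

Local Open Scope R_scope.

(** * Series of complex numbers *)

(** Since [hurwitz_zeta] is an epsilon choice, nothing is known about it until some continuation has
    been exhibited; the identity theorem on the plane without the point 1 then transfers every
    value. Expanding (nu - x)^(-s) for all nu >= N requires |x| < N. With x = -alpha the sum may
    start at N = 1, but the case x = 1 that continues zeta has to start at N = 2, which is why zeta
    - 1 is continued before zeta. The same inequality makes the expansion converge for every s: the
    Dirichlet series from N on, taken at s + k, decays like N^(-k), which leaves the geometric
    factor (|x| / N)^k against the polynomial growth of (s)_k / k!. *)

Notation Cis_series := (@is_series C_AbsRing C_NormedModule).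
Notation Csum := (@sum_n C_AbelianMonoid).

Lemma Csum_S (u : nat -> C) n : Csum u (S n) = (Csum u n + u (S n))%C.
Proof. exact (sum_Sn (G := C_AbelianMonoid) u n). Qed.

Lemma Csum_0 (u : nat -> C) : Csum u 0 = u 0%nat.
Proof. exact (sum_O (G := C_AbelianMonoid) u). Qed.

(** The uniform structure on C is that of a product, so its balls are squares; comparing them with
    discs for [Cmod] costs the factor sqrt 2. *)
Lemma Cis_series_eps (u : nat -> C) (l : C) :
  Cis_series u l <->
  forall eps, 0 < eps ->
    exists N, forall n, (N <= n)%nat -> Cmod (Csum u n - l)%C < eps.
Proof.
split.
- intros H eps He.
  assert (He' : 0 < eps / sqrt 2) by (apply Rdiv_lt_0_compat; [easy | apply sqrt_lt_R0; lra]).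
  destruct (proj1 (filterlim_locally _ _) H (mkposreal _ He')) as [N HN].
  exists N. intros n Hn.
  generalize (C_NormedModule_mixin_compat2 _ _ _ (HN n Hn)); simpl.
  replace (sqrt 2 * (eps / sqrt 2)) with eps; [easy|].
  field. apply Rgt_not_eq, sqrt_lt_R0; lra.
- intros H. apply filterlim_locally. intros eps.
  destruct (H eps (cond_pos eps)) as [N HN].
  exists N. intros n Hn.
  exact (C_NormedModule_mixin_compat1 l (Csum u n) eps (HN n Hn)).
Qed.

Lemma Cmod_lt_eps_eq0 (z : C) : (forall eps, 0 < eps -> Cmod z < eps) -> z = RtoC 0.
Proof.
intros H. apply Cmod_eq_0.
destruct (Rle_lt_or_eq_dec _ _ (Cmod_ge_0 z)) as [h | h]; [|easy].
specialize (H _ h). lra.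
Qed.

Lemma Cis_series_unique (u : nat -> C) (l1 l2 : C) :
  Cis_series u l1 -> Cis_series u l2 -> l1 = l2.
Proof.
rewrite !Cis_series_eps. intros H1 H2.
apply Ceq_minus, Cmod_lt_eps_eq0. intros eps He.
destruct (H1 (eps / 2)) as [N1 HN1]; [lra|].
destruct (H2 (eps / 2)) as [N2 HN2]; [lra|].
specialize (HN1 (N1 + N2)%nat ltac:(lia)). specialize (HN2 (N1 + N2)%nat ltac:(lia)).
set (s := Csum u (N1 + N2)) in *.
replace (l1 - l2)%C with (- (s - l1) + (s - l2))%C by ring.
eapply Rle_lt_trans; [apply Cmod_triangle|]. rewrite Cmod_opp. lra.
Qed.

Lemma Csum_Re (u : nat -> C) n : Re (Csum u n) = sum_n (fun k => Re (u k)) n.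
Proof.
induction n as [|n IH]; [now rewrite Csum_0, sum_O|].
rewrite Csum_S, sum_Sn, <- IH. reflexivity.
Qed.

Lemma Csum_Im (u : nat -> C) n : Im (Csum u n) = sum_n (fun k => Im (u k)) n.
Proof.
induction n as [|n IH]; [now rewrite Csum_0, sum_O|].
rewrite Csum_S, sum_Sn, <- IH. reflexivity.
Qed.

Lemma Cis_series_re_im (u : nat -> C) (l : C) :
  Cis_series u l <->
  is_series (fun k => Re (u k)) (Re l) /\ is_series (fun k => Im (u k)) (Im l).
Proof.
split.
- intros H; split; apply filterlim_locally; intros eps;
    destruct (proj1 (filterlim_locally _ _) H eps) as [N HN];
    exists N; intros n Hn; destruct (HN n Hn) as [h1 h2].
  + rewrite <- Csum_Re. exact h1.
  + rewrite <- Csum_Im. exact h2.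
- intros [H1 H2]. apply filterlim_locally. intros eps.
  destruct (proj1 (filterlim_locally _ _) H1 eps) as [N1 HN1].
  destruct (proj1 (filterlim_locally _ _) H2 eps) as [N2 HN2].
  exists (N1 + N2)%nat. intros n Hn. split.
  + specialize (HN1 n ltac:(lia)). rewrite <- Csum_Re in HN1. exact HN1.
  + specialize (HN2 n ltac:(lia)). rewrite <- Csum_Im in HN2. exact HN2.
Qed.

Lemma sum_n_incr_le (a : nat -> R) n : (forall k, 0 <= a k) -> sum_n a n <= sum_n a (S n).
Proof. intros H. rewrite sum_Sn. specialize (H (S n)). unfold plus; simpl. lra. Qed.

Lemma sum_n_le_loc (a b : nat -> R) n :
  (forall k, (k <= n)%nat -> a k <= b k) -> sum_n a n <= sum_n b n.
Proof.
induction n as [|n IH]; intros H.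
- rewrite !sum_O. apply H; lia.
- rewrite !sum_Sn. apply Rplus_le_compat; [apply IH; intros; apply H; lia | apply H; lia].
Qed.

Lemma sum_n_nonneg (a : nat -> R) n : (forall k, 0 <= a k) -> 0 <= sum_n a n.
Proof.
intros H. induction n as [|n IH]; [rewrite sum_O; apply H|].
eapply Rle_trans; [exact IH|]. now apply sum_n_incr_le.
Qed.

Lemma sum_n_le_is_series (a : nat -> R) l n :
  (forall k, 0 <= a k) -> is_series a l -> sum_n a n <= l.
Proof.
intros H Hs. apply (is_lim_seq_incr_compare (sum_n a) l); [exact Hs|].
intros k; now apply sum_n_incr_le.
Qed.

Lemma ex_series_bounded (a : nat -> R) M :
  (forall k, 0 <= a k) -> (forall n, sum_n a n <= M) -> ex_series a.
Proof.
intros H HM.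
destruct (ex_finite_lim_seq_incr (sum_n a) M) as [l Hl];
  [intros; now apply sum_n_incr_le | exact HM |].
exists l. exact Hl.
Qed.

Lemma Cmod_Csum (u : nat -> C) n : Cmod (Csum u n) <= sum_n (fun k => Cmod (u k)) n.
Proof.
induction n as [|n IH]; [rewrite Csum_0, sum_O; lra|].
rewrite Csum_S, sum_Sn. eapply Rle_trans; [apply Cmod_triangle|].
unfold plus; simpl; lra.
Qed.

Lemma Cis_series_Cmod_le (u : nat -> C) (l : C) M :
  (forall n, sum_n (fun k => Cmod (u k)) n <= M) -> Cis_series u l -> Cmod l <= M.
Proof.
intros HM Hl. apply Rnot_lt_le. intros h.
destruct (proj1 (Cis_series_eps _ _) Hl (Cmod l - M)) as [N HN]; [lra|].
specialize (HN N (Nat.le_refl _)).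
assert (h1 := Rle_trans _ _ _ (Cmod_Csum u N) (HM N)).
assert (h2 : Cmod l <= Cmod (Csum u N - l) + Cmod (Csum u N)).
{ replace l with (- (Csum u N - l) + Csum u N)%C at 1 by ring.
  eapply Rle_trans; [apply Cmod_triangle|]. rewrite Cmod_opp. lra. }
lra.
Qed.

Lemma im_le_Cmod (z : C) : Rabs (Im z) <= Cmod z.
Proof. eapply Rle_trans; [apply Rmax_r | apply Rmax_Cmod]. Qed.

Lemma Cis_series_abs (u : nat -> C) M :
  (forall n, sum_n (fun k => Cmod (u k)) n <= M) ->
  exists l : C, Cis_series u l /\ Cmod l <= M.
Proof.
intros HM.
assert (Hu : ex_series (fun k => Cmod (u k)))
  by (apply (ex_series_bounded _ M); [intros; apply Cmod_ge_0 | exact HM]).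
assert (H1 : ex_series (fun k => Re (u k)))
  by (apply (ex_series_le (V := R_CompleteNormedModule) _ (fun k => Cmod (u k))); [intros; apply re_le_Cmod | exact Hu]).
assert (H2 : ex_series (fun k => Im (u k)))
  by (apply (ex_series_le (V := R_CompleteNormedModule) _ (fun k => Cmod (u k))); [intros; apply im_le_Cmod | exact Hu]).
destruct H1 as [l1 H1], H2 as [l2 H2].
assert (H : Cis_series u (l1, l2)) by (apply Cis_series_re_im; split; assumption).
exists (l1, l2). split; [exact H|]. exact (Cis_series_Cmod_le _ _ _ HM H).
Qed.

(** N is the index of the last term removed, so N + 1 terms leave the series. *)
Lemma Cis_series_shift (u : nat -> C) (l : C) N :
  Cis_series u l -> Cis_series (fun k => u (S N + k)%nat) (l - Csum u N)%C.
Proof.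
intros H. apply (is_series_incr_n (V := C_NormedModule) u (S N)); [lia|].
replace (plus _ _) with l; [exact H|].
change (l = (l - Csum u N + Csum u N)%C). ring.
Qed.

Lemma Cis_series_unshift (u : nat -> C) (l : C) N :
  Cis_series (fun k => u (S N + k)%nat) l -> Cis_series u (l + Csum u N)%C.
Proof.
intros H. apply (is_series_decr_n (V := C_NormedModule) u (S N)); [lia|].
replace (plus _ _) with l; [exact H|].
change (l = (l + Csum u N - Csum u N)%C). ring.
Qed.

Lemma Cis_series_ext (u v : nat -> C) (l : C) :
  (forall n, u n = v n) -> Cis_series u l -> Cis_series v l.
Proof. exact (is_series_ext (V := C_NormedModule) u v l). Qed.

Lemma Cis_series_plus (u v : nat -> C) (l1 l2 : C) :
  Cis_series u l1 -> Cis_series v l2 -> Cis_series (fun n => (u n + v n)%C) (l1 + l2)%C.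
Proof. exact (is_series_plus (V := C_NormedModule) u v l1 l2). Qed.

Lemma Cis_series_scal (c : C) (u : nat -> C) (l : C) :
  Cis_series u l -> Cis_series (fun n => (c * u n)%C) (c * l)%C.
Proof. exact (is_series_scal (V := C_NormedModule) c u l). Qed.

Lemma Cis_series_minus (u v : nat -> C) (l1 l2 : C) :
  Cis_series u l1 -> Cis_series v l2 -> Cis_series (fun n => (u n - v n)%C) (l1 - l2)%C.
Proof. exact (is_series_minus (V := C_NormedModule) u v l1 l2). Qed.

(** Dominated convergence for series: finitely many terms become small with K, and the tail of [M]
    bounds what remains uniformly in K. *)
Lemma tannery (rho : nat -> nat -> C) (M : nat -> R) (T : nat -> C) :
  ex_series M ->
  (forall K n, Cmod (rho K n) <= M n) ->
  (forall n eps, 0 < eps -> exists K0, forall K, (K0 <= K)%nat -> Cmod (rho K n) < eps) ->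
  (forall K, Cis_series (rho K) (T K)) ->
  forall eps, 0 < eps -> exists K0, forall K, (K0 <= K)%nat -> Cmod (T K) < eps.
Proof.
intros HMs Hle H0 HT eps He.
assert (HM := Series_correct _ HMs). set (S := Series M) in HM.
assert (HMpos : forall n, 0 <= M n)
  by (intros n; eapply Rle_trans; [apply (Cmod_ge_0 (rho 0%nat n)) | apply Hle]).
destruct (proj1 (filterlim_locally _ _) HM (mkposreal (eps / 2) ltac:(lra))) as [N HN].
specialize (HN N (Nat.le_refl _)).
assert (Hfin : forall e, 0 < e ->
  exists K0, forall K, (K0 <= K)%nat -> Cmod (Csum (rho K) N) < e).
{ clear HN. induction N as [|N IH]; intros e Hpe.
  - destruct (H0 0%nat e Hpe) as [K0 HK]. exists K0. intros K h. rewrite Csum_0. auto.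
  - destruct (IH (e / 2)) as [K1 HK1]; [lra|].
    destruct (H0 (Datatypes.S N) (e / 2)) as [K2 HK2]; [lra|].
    exists (K1 + K2)%nat. intros K h. rewrite Csum_S.
    eapply Rle_lt_trans; [apply Cmod_triangle|].
    specialize (HK1 K ltac:(lia)). specialize (HK2 K ltac:(lia)). lra. }
destruct (Hfin (eps / 2)) as [K0 HK0]; [lra|].
exists K0. intros K HK. specialize (HK0 K HK).
assert (Htail : Cmod (T K - Csum (rho K) N) <= S - sum_n M N).
{ apply (Cis_series_Cmod_le _ _ _) with (2 := Cis_series_shift _ _ N (HT K)).
  intros n. eapply Rle_trans; [apply sum_n_le_loc; intros k _; apply Hle|].
  apply (sum_n_le_is_series (fun k => M (Datatypes.S N + k)%nat));
    [intros; apply HMpos|].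
  apply (is_series_incr_n M (Datatypes.S N)); [lia|].
  replace (plus _ _) with S; [exact HM|].
  change (S = S - sum_n M N + sum_n M N). ring. }
replace (T K) with (Csum (rho K) N + (T K - Csum (rho K) N))%C by ring.
eapply Rle_lt_trans; [apply Cmod_triangle|].
change (Rabs (sum_n M N - S) < eps / 2) in HN. apply Rabs_def2 in HN. lra.
Qed.

Lemma Cis_series_Csum (c : nat -> nat -> C) (col : nat -> C) K :
  (forall k, Cis_series (fun n => c n k) (col k)) ->
  Cis_series (fun n => Csum (c n) K) (Csum col K).
Proof.
intros H. induction K as [|K IH].
- rewrite Csum_0. apply (Cis_series_ext (fun n => c n 0%nat)); [|apply H].
  intros n; now rewrite Csum_0.
- rewrite Csum_S. apply (Cis_series_ext (fun n => (Csum (c n) K + c n (S K))%C)).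
  + intros n; now rewrite Csum_S.
  + apply Cis_series_plus; auto.
Qed.

(** Interchange of the two summations. The sum over n of the K-th partial row sums is the K-th
    partial sum of [col]; its distance to T is a series of row remainders, each at most 2 * M n, to
    which [tannery] applies. *)
Lemma Cis_series_swap (c : nat -> nat -> C) (M : nat -> R) (row col : nat -> C) (T : C) :
  (forall n N, sum_n (fun k => Cmod (c n k)) N <= M n) ->
  ex_series M ->
  (forall n, Cis_series (c n) (row n)) ->
  (forall k, Cis_series (fun n => c n k) (col k)) ->
  Cis_series row T ->
  Cis_series col T.
Proof.
intros HM HMs Hrow Hcol HT.
apply Cis_series_eps. intros eps He.
destruct (tannery (fun K n => Csum (c n) K - row n)%C (fun n => 2 * M n)
  (fun K => Csum col K - T)%C) with (eps := eps) as [K0 HK0].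
- exists (2 * Series M). exact (is_series_scal 2 M _ (Series_correct _ HMs)).
- intros K n.
  assert (h1 := Rle_trans _ _ _ (Cmod_Csum (c n) K) (HM n K)).
  assert (h2 := Cis_series_Cmod_le _ _ _ (HM n) (Hrow n)).
  unfold Cminus. eapply Rle_trans; [apply Cmod_triangle|]. rewrite Cmod_opp. lra.
- intros n. apply Cis_series_eps, Hrow.
- intros K. apply Cis_series_minus; [now apply Cis_series_Csum | exact HT].
- exact He.
- exists K0. exact HK0.
Qed.

(** The column sums inherit the row bounds, because a finite sum over k commutes with the series
    over n of |c n k|. This is how majorants of power series survive infinite summation. *)
Lemma double_sum_bound (c : nat -> nat -> C) (M : nat -> R) (col : nat -> C) :
  (forall n N, sum_n (fun k => Cmod (c n k)) N <= M n) ->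
  ex_series M ->
  (forall k, Cis_series (fun n => c n k) (col k)) ->
  forall N, sum_n (fun k => Cmod (col k)) N <= Series M.
Proof.
intros HM HMs Hcol N.
assert (HMpos : forall n, 0 <= M n).
{ intros n. eapply Rle_trans; [|apply (HM n 0%nat)]. rewrite sum_O. apply Cmod_ge_0. }
assert (Hck : forall k, ex_series (fun n => Cmod (c n k))).
{ intros k. apply (ex_series_le (V := R_CompleteNormedModule) _ M); [|exact HMs].
  intros n. eapply Rle_trans; [|apply (HM n k)].
  change (norm ?x) with (Rabs x). rewrite Rabs_pos_eq by apply Cmod_ge_0.
  destruct k; [rewrite sum_O; lra|]. rewrite sum_Sn.
  assert (0 <= sum_n (fun k0 => Cmod (c n k0)) k) by (apply sum_n_nonneg; intros; apply Cmod_ge_0).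
  unfold plus; simpl; lra. }
apply Rle_trans with (sum_n (fun k => Series (fun n => Cmod (c n k))) N).
{ apply sum_n_le_loc. intros k _.
  apply (Cis_series_Cmod_le _ _ _) with (2 := Hcol k).
  intros n. apply (sum_n_le_is_series (fun n0 => Cmod (c n0 k))); [intros; apply Cmod_ge_0|].
  now apply Series_correct. }
assert (Hs : is_series (fun n => sum_n (fun k => Cmod (c n k)) N)
   (sum_n (fun k => Series (fun n => Cmod (c n k))) N)).
{ induction N as [|N IH].
  - rewrite sum_O. apply (is_series_ext (fun n => Cmod (c n 0%nat))).
    + intros n; now rewrite sum_O.
    + now apply Series_correct.
  - rewrite sum_Sn. apply (is_series_ext (fun n =>
       plus (sum_n (fun k => Cmod (c n k)) N) (Cmod (c n (S N))))).
    + intros n; now rewrite sum_Sn.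
    + apply (is_series_plus (V := R_NormedModule)); [exact IH | now apply Series_correct]. }
rewrite <- (is_series_unique _ _ Hs).
apply Series_le; [|exact HMs]. intros n; split; [|apply HM].
apply sum_n_nonneg; intros; apply Cmod_ge_0.
Qed.

Lemma Cis_series_head (u : nat -> C) :
  (forall n, u (S n) = RtoC 0) -> Cis_series u (u 0%nat).
Proof.
intros H. apply Cis_series_eps. intros eps He. exists 0%nat. intros n _.
replace (Csum u n) with (u 0%nat).
- replace (u 0%nat - u 0%nat)%C with (RtoC 0) by ring. now rewrite Cmod_0.
- induction n as [|n IH]; [now rewrite Csum_0|]. rewrite Csum_S, <- IH, H. ring.
Qed.

(** * Exponential and binomial series *)

(** Paths in C are differentiated componentwise so that real calculus applies to each component. *)
Definition is_cderive (f : R -> C) (t : R) (l : C) : Prop :=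
  is_derive (fun t => Re (f t)) t (Re l) /\ is_derive (fun t => Im (f t)) t (Im l).

Lemma is_derive_Rmult (f g : R -> R) t df dg :
  is_derive f t df -> is_derive g t dg ->
  is_derive (fun t => f t * g t) t (df * g t + f t * dg).
Proof.
intros Hf Hg. exact (is_derive_mult f g t df dg Hf Hg Rmult_comm).
Qed.

Lemma is_cderive_mult (f g : R -> C) t (lf lg : C) :
  is_cderive f t lf -> is_cderive g t lg ->
  is_cderive (fun t => (f t * g t)%C) t (lf * g t + f t * lg)%C.
Proof.
intros [f1 f2] [g1 g2]; split; simpl.
- evar_last.
  + apply (is_derive_minus (V := R_NormedModule)); apply is_derive_Rmult; eassumption.
  + unfold minus, plus, opp, Re, Im; simpl; ring.
- evar_last.
  + apply (is_derive_plus (V := R_NormedModule)); apply is_derive_Rmult; eassumption.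
  + unfold plus, Re, Im; simpl; ring.
Qed.

Lemma is_cderive_const (c : C) t : is_cderive (fun _ => c) t (RtoC 0).
Proof. split; apply (is_derive_const (V := R_NormedModule)). Qed.

Lemma is_cderive_scal (c : C) (f : R -> C) t (l : C) :
  is_cderive f t l -> is_cderive (fun t => (c * f t)%C) t (c * l)%C.
Proof.
intros H. generalize (is_cderive_mult _ _ _ _ _ (is_cderive_const c t) H).
now replace (0 * f t + c * l)%C with (c * l)%C by ring.
Qed.

Lemma is_cderive_cexp (f : R -> C) t (l : C) :
  is_cderive f t l -> is_cderive (fun t => cexp (f t)) t (l * cexp (f t))%C.
Proof.
intros [f1 f2].
assert (He : is_derive (fun t => exp (Re (f t))) t (Re l * exp (Re (f t))))
  by (apply (is_derive_comp exp (fun t => Re (f t))); [apply is_derive_exp | exact f1]).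
assert (Hc : is_derive (fun t => cos (Im (f t))) t (Im l * - sin (Im (f t))))
  by (apply (is_derive_comp cos (fun t => Im (f t))); [apply is_derive_cos | exact f2]).
assert (Hs : is_derive (fun t => sin (Im (f t))) t (Im l * cos (Im (f t))))
  by (apply (is_derive_comp sin (fun t => Im (f t))); [apply is_derive_sin | exact f2]).
split; simpl.
- evar_last.
  + exact (is_derive_Rmult _ _ _ _ _ He Hc).
  + unfold Re, Im; simpl; ring.
- evar_last.
  + exact (is_derive_Rmult _ _ _ _ _ He Hs).
  + unfold Re, Im; simpl; ring.
Qed.

Lemma is_cderive_0_eq (f : R -> C) :
  (forall t, 0 <= t <= 1 -> is_cderive f t (RtoC 0)) -> f 0 = f 1.
Proof.
intros H.
assert (H1 := eq_is_derive (fun t => Re (f t)) 0 1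
  (fun t Ht => proj1 (H t Ht)) Rlt_0_1).
assert (H2 := eq_is_derive (fun t => Im (f t)) 0 1
  (fun t Ht => proj2 (H t Ht)) Rlt_0_1).
apply injective_projections; [exact H1 | exact H2].
Qed.

(** Bounded terms at rho > 1 put the whole interval [0, 1] inside the disc of convergence of the
    real and of the imaginary coefficients. *)
Lemma is_cderive_pseries (c : nat -> C) (rho M : R) :
  1 < rho ->
  (forall n, Cmod (c n) * rho ^ n <= M) ->
  exists phi dphi : R -> C, forall t, 0 <= t <= 1 ->
    is_cderive phi t (dphi t) /\
    Cis_series (fun k => (c k * t ^ k)%C) (phi t) /\
    Cis_series (fun k => (INR (S k) * c (S k) * t ^ k)%C) (dphi t).
Proof.
intros Hrho HM.
assert (HR : forall t, 0 <= t <= 1 -> forall p : C -> R, (forall z, Rabs (p z) <= Cmod z) ->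
   Rbar_lt (Rabs t) (CV_radius (fun k => p (c k)))).
{ intros t Ht p Hp. apply (Rbar_lt_le_trans _ rho).
  - simpl. rewrite Rabs_pos_eq; lra.
  - apply (proj1 (CV_radius_bounded (fun k => p (c k)))).
    exists M. intros n. eapply Rle_trans; [|apply (HM n)].
    assert (0 < rho ^ n) by (apply pow_lt; lra).
    rewrite Rabs_mult, (Rabs_pos_eq (rho ^ n)) by lra.
    apply Rmult_le_compat_r; [lra | apply Hp]. }
exists (fun t => (PSeries (fun k => Re (c k)) t, PSeries (fun k => Im (c k)) t)).
exists (fun t => (PSeries (PS_derive (fun k => Re (c k))) t,
                  PSeries (PS_derive (fun k => Im (c k))) t)).
intros t Ht.
assert (H1 := HR t Ht Re re_le_Cmod). assert (H2 := HR t Ht Im im_le_Cmod).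
split; [|split].
- split; simpl; now apply is_derive_PSeries.
- apply Cis_series_re_im; split; simpl.
  + apply (is_series_ext (fun k => Re (c k) * t ^ k)).
    * intros n. rewrite <- RtoC_pow. unfold Re, Im; simpl; ring.
    * apply is_pseries_R, PSeries_correct, CV_radius_inside, H1.
  + apply (is_series_ext (fun k => Im (c k) * t ^ k)).
    * intros n. rewrite <- RtoC_pow. unfold Re, Im; simpl; ring.
    * apply is_pseries_R, PSeries_correct, CV_radius_inside, H2.
- rewrite <- CV_radius_derive in H1, H2.
  apply Cis_series_re_im; split.
  + apply (is_series_ext (fun k => PS_derive (fun k => Re (c k)) k * t ^ k)).
    * intros n. rewrite <- RtoC_pow. unfold PS_derive. rewrite re_scal_r, re_scal_l. reflexivity.
    * apply is_pseries_R, PSeries_correct, CV_radius_inside, H1.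
  + apply (is_series_ext (fun k => PS_derive (fun k => Im (c k)) k * t ^ k)).
    * intros n. rewrite <- RtoC_pow. unfold PS_derive. rewrite im_scal_r, im_scal_l. reflexivity.
    * apply is_pseries_R, PSeries_correct, CV_radius_inside, H2.
Qed.

(* Both the power series and 1/E solve the linear equation (1 + x t) y' = q y
   on [0, 1]. *)
Lemma pseries_linear_ode (c : nat -> C) (rho M : R) (x q : C) (E dE : R -> C) :
  1 < rho ->
  (forall n, Cmod (c n) * rho ^ n <= M) ->
  (forall k, (INR (S k) * c (S k) + x * INR k * c k = q * c k)%C) ->
  (forall t, 0 <= t <= 1 -> (1 + t * x)%C <> RtoC 0) ->
  (forall t, 0 <= t <= 1 ->
     is_cderive E t (dE t) /\ ((1 + t * x) * dE t = - q * E t)%C) ->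
  exists l : C, Cis_series c l /\ (l * E 1 = c 0%nat * E 0)%C.
Proof.
intros Hrho HM Hrec Hnz HE.
destruct (is_cderive_pseries c rho M Hrho HM) as (phi & dphi & H).
assert (Hode : forall t, 0 <= t <= 1 -> ((1 + t * x) * dphi t = q * phi t)%C).
{ intros t Ht. destruct (H t Ht) as (_ & H1 & H2).
  apply (Cis_series_unique (fun k => (q * (c k * t ^ k))%C)); [|now apply Cis_series_scal].
  apply (Cis_series_ext
    (fun k => (INR (S k) * c (S k) * t ^ k + x * (INR k * c k * t ^ k))%C)).
  - intros k. transitivity ((INR (S k) * c (S k) + x * INR k * c k) * t ^ k)%C; [ring|].
    rewrite Hrec. ring.
  - replace ((1 + t * x) * dphi t)%C with (dphi t + x * (t * dphi t))%C by ring.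
    apply Cis_series_plus; [exact H2|]. apply Cis_series_scal.
    (* The term k = 0 of the series of k c_k t^k vanishes; adding it realigns the indices. *)
    replace (t * dphi t)%C with (t * dphi t + Csum (fun k => (INR k * c k * t ^ k)%C) 0)%C.
    + apply Cis_series_unshift.
      apply (Cis_series_ext (fun k => (t * (INR (S k) * c (S k) * t ^ k))%C)).
      * intros k. change (1 + k)%nat with (S k). rewrite Cpow_S. ring.
      * now apply Cis_series_scal.
    + rewrite Csum_0. simpl. ring. }
exists (phi 1). split.
- destruct (H 1) as (_ & H1 & _); [lra|].
  apply (Cis_series_ext (fun k => (c k * RtoC 1 ^ k)%C)); [|exact H1].
  intros k. rewrite Cpow_1_l. ring.
- assert (H0 : phi 0 = c 0%nat).
  { destruct (H 0) as (_ & H1 & _); [lra|].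
    apply (Cis_series_unique _ _ _ H1).
    replace (c 0%nat) with (c 0%nat * RtoC 0 ^ 0)%C by (simpl; ring).
    apply (Cis_series_head (fun k => (c k * RtoC 0 ^ k)%C)).
    intros n. rewrite Cpow_S. ring. }
  rewrite <- H0. symmetry.
  (* The product phi E is constant: (1 + t x) (phi E)' = q phi E - q phi E = 0. *)
  apply (is_cderive_0_eq (fun t => (phi t * E t)%C)).
  intros t Ht. destruct (H t Ht) as (Hd & _ & _). destruct (HE t Ht) as [HdE HoE].
  replace (RtoC 0) with (dphi t * E t + phi t * dE t)%C; [now apply is_cderive_mult|].
  specialize (Hnz t Ht). specialize (Hode t Ht).
  transitivity ((1 + t * x) * (dphi t * E t + phi t * dE t) / (1 + t * x))%C; [now field|].
  replace ((1 + t * x) * (dphi t * E t + phi t * dE t))%C with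
    ((1 + t * x) * dphi t * E t + phi t * ((1 + t * x) * dE t))%C by ring.
  rewrite Hode, HoE. now field.
Qed.

(** * Pochhammer symbols and their majorants *)

Fixpoint poch (s : C) (k : nat) : C :=
  match k with O => RtoC 1 | S k => (poch s k * (s + INR k))%C end.

Fixpoint rpoch (b : R) (k : nat) : R :=
  match k with O => 1 | S k => rpoch b k * (b + INR k) end.

Lemma rpoch_nonneg b k : 0 <= b -> 0 <= rpoch b k.
Proof.
intros Hb. induction k as [|k IH]; simpl rpoch; [lra|].
apply Rmult_le_pos; [easy|]. generalize (pos_INR k); lra.
Qed.

Lemma rpoch_le b b' k : 0 <= b <= b' -> rpoch b k <= rpoch b' k.
Proof.
intros Hb. induction k as [|k IH]; simpl rpoch; [lra|].
generalize (pos_INR k); intros Hk.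
apply Rmult_le_compat; [now apply rpoch_nonneg | lra | exact IH | lra].
Qed.

Lemma Cmod_INR n : Cmod (RtoC (INR n)) = INR n.
Proof. rewrite Cmod_R. apply Rabs_pos_eq, pos_INR. Qed.

Lemma Cmod_poch_le s b k : Cmod s <= b -> Cmod (poch s k) <= rpoch b k.
Proof.
intros Hb. induction k as [|k IH]; simpl rpoch; simpl poch; [rewrite Cmod_1; lra|].
rewrite Cmod_mult.
apply Rmult_le_compat; [apply Cmod_ge_0 | apply Cmod_ge_0 | exact IH |].
eapply Rle_trans; [apply Cmod_triangle|]. rewrite Cmod_INR. lra.
Qed.

Lemma INR_fact_pos n : 0 < INR (fact n).
Proof. apply INR_fact_lt_0. Qed.

Lemma INR_fact_S n : INR (fact (S n)) = INR (S n) * INR (fact n).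
Proof. rewrite <- mult_INR. reflexivity. Qed.

(** The coefficient of q^k in (1 - q)^(-b), a majorant of (s)_k / k! for |s| <= b. *)
Definition binom_coef (b : R) (k : nat) : R := rpoch b k / INR (fact k).

Lemma binom_coef_nonneg b k : 0 <= b -> 0 <= binom_coef b k.
Proof.
intros Hb. apply Rmult_le_pos; [now apply rpoch_nonneg|].
apply Rlt_le, Rinv_0_lt_compat, INR_fact_pos.
Qed.

(** The ratio test needs nonzero terms, which fail for b = 0 or q = 0. It is therefore applied to
    the larger series with b + 1 for b and some p in (q, 1) for q, whose ratio is p + p b / (k +
    1). *)
Lemma ex_series_binom_coef b q :
  0 <= b -> 0 <= q < 1 -> ex_series (fun k => binom_coef b k * q ^ k).
Proof.
intros Hb Hq. set (p := (q + 1) / 2).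
assert (Hp : 0 < p < 1) by (unfold p; lra).
assert (Hpos : forall k, 0 < binom_coef (b + 1) k * p ^ k).
{ intros k. apply Rmult_lt_0_compat; [|apply pow_lt; lra].
  apply Rdiv_lt_0_compat; [|apply INR_fact_pos].
  induction k as [|k IH]; simpl rpoch; [lra|].
  apply Rmult_lt_0_compat; [exact IH|]. generalize (pos_INR k); lra. }
apply (ex_series_le (V := R_CompleteNormedModule) _
         (fun k => Rabs (binom_coef (b + 1) k * p ^ k))).
- intros k. change (norm ?x) with (Rabs x).
  rewrite !Rabs_pos_eq; [| apply Rlt_le, Hpos |
    apply Rmult_le_pos; [now apply binom_coef_nonneg | apply pow_le; lra]].
  apply Rmult_le_compat; [now apply binom_coef_nonneg | apply pow_le; lra | |
    apply pow_incr; unfold p; lra].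
  apply Rmult_le_compat_r; [apply Rlt_le, Rinv_0_lt_compat, INR_fact_pos|].
  apply rpoch_le; lra.
- apply ex_series_DAlembert with p; [lra | intros k; apply Rgt_not_eq, Hpos |].
  apply (is_lim_seq_ext (fun k => p + p * b * / INR (S k))).
  + intros k. rewrite Rabs_pos_eq by (apply Rlt_le, Rdiv_lt_0_compat; apply Hpos).
    unfold binom_coef in *. specialize (Hpos k). simpl rpoch. simpl pow.
    rewrite INR_fact_S. assert (H1 := INR_fact_pos k). assert (H2 := pos_INR k).
    rewrite S_INR in *. field.
    repeat split; try lra.
    * intros h. rewrite h in Hpos. lra.
    * intros h. rewrite h in Hpos. lra.
  + replace (Finite p) with (Finite (p + p * b * 0)) by (f_equal; ring).
    apply is_lim_seq_plus'; [apply is_lim_seq_const|].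
    apply (is_lim_seq_scal_l _ (p * b) 0).
    apply (is_lim_seq_inv _ p_infty); [|easy].
    apply -> is_lim_seq_incr_1. apply is_lim_seq_INR.
Qed.

Lemma term_le_sum_n (a : nat -> R) n : (forall k, 0 <= a k) -> a n <= sum_n a n.
Proof.
intros Ha. destruct n; [rewrite sum_O; lra|]. rewrite sum_Sn.
assert (h := sum_n_nonneg a n Ha). change (a (S n) <= sum_n a n + a (S n)). lra.
Qed.

Lemma ex_series_term_le (a : nat -> R) :
  (forall k, 0 <= a k) -> ex_series a -> forall n, a n <= Series a.
Proof.
intros Ha Hs n. apply Rle_trans with (sum_n a n).
- now apply term_le_sum_n.
- apply sum_n_le_is_series; [exact Ha | now apply Series_correct].
Qed.

(** * Complex exponential, principal logarithm and binomial series *)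

Lemma cexp_plus (a b : C) : cexp (a + b)%C = (cexp a * cexp b)%C.
Proof.
unfold cexp, Re, Im. apply injective_projections; simpl;
  rewrite exp_plus, ?cos_plus, ?sin_plus; ring.
Qed.

Lemma cexp_0 : cexp (RtoC 0) = RtoC 1.
Proof.
unfold cexp, RtoC; simpl. rewrite exp_0, cos_0, sin_0. f_equal; ring.
Qed.

Lemma cexp_opp_r (a : C) : (cexp a * cexp (- a))%C = RtoC 1.
Proof. rewrite <- cexp_plus, Cplus_opp_r. apply cexp_0. Qed.

Lemma Cmod_cexp (a : C) : Cmod (cexp a) = exp (Re a).
Proof.
unfold cexp, Cmod; simpl.
replace (_ + _) with (exp (Re a) ^ 2 * (Rsqr (sin (Im a)) + Rsqr (cos (Im a))))
  by (unfold Rsqr; ring).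
rewrite sin2_cos2, Rmult_1_r. apply sqrt_pow2, Rlt_le, exp_pos.
Qed.

Lemma cexp_RtoC (x : R) : cexp (RtoC x) = RtoC (exp x).
Proof. unfold cexp, RtoC; simpl. rewrite cos_0, sin_0. f_equal; ring. Qed.

Lemma Cmod_pow_div_fact (w : C) k :
  Cmod (w ^ k * RtoC (/ INR (fact k)))%C = / INR (fact k) * Cmod w ^ k.
Proof.
rewrite Cmod_mult, Cmod_pow, Cmod_R, Rabs_pos_eq; [ring|].
apply Rlt_le, Rinv_0_lt_compat, INR_fact_pos.
Qed.

Lemma sum_exp_le (x : R) n :
  0 <= x -> sum_n (fun k => / INR (fact k) * x ^ k) n <= exp x.
Proof.
intros Hx. apply sum_n_le_is_series.
- intros k. apply Rmult_le_pos; [|now apply pow_le].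
  apply Rlt_le, Rinv_0_lt_compat, INR_fact_pos.
- apply is_pseries_R, is_exp_Reals.
Qed.

(** The instance x = 0, q = w, E(t) = exp(-w t) of [pseries_linear_ode]. With rho = 2 every term
    |w|^k 2^k / k! is at most exp(2 |w|). *)
Lemma cexp_series (w : C) :
  Cis_series (fun k => w ^ k * RtoC (/ INR (fact k)))%C (cexp w).
Proof.
destruct (pseries_linear_ode (fun k => w ^ k * RtoC (/ INR (fact k)))%C 2
  (exp (2 * Cmod w)) (RtoC 0) w (fun t => cexp (- w * t)%C)
  (fun t => - w * cexp (- w * t))%C) as (l & Hl & He).
- lra.
- intros n. rewrite Cmod_pow_div_fact.
  assert (Hw : 0 <= 2 * Cmod w) by (generalize (Cmod_ge_0 w); lra).
  eapply Rle_trans; [|apply (sum_exp_le (2 * Cmod w) n Hw)].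
  rewrite Rmult_assoc, <- Rpow_mult_distr, (Rmult_comm (Cmod w)).
  assert (H0 : forall k, 0 <= / INR (fact k) * (2 * Cmod w) ^ k).
  { intros k. apply Rmult_le_pos; [|now apply pow_le].
    apply Rlt_le, Rinv_0_lt_compat, INR_fact_pos. }
  exact (term_le_sum_n _ n H0).
- intros k. rewrite INR_fact_S. rewrite Rinv_mult, RtoC_mult, Cpow_S.
  rewrite (RtoC_inv (INR (S k))) by (apply not_0_INR; lia).
  field. intros h. apply RtoC_inj in h. revert h. apply not_0_INR; lia.
- intros t _. replace (1 + t * 0)%C with (RtoC 1) by ring. apply C1_nz.
- intros t _. split; [|ring]. apply is_cderive_cexp.
  enough (h : is_cderive (fun t => - w * t)%C t (- w * 1)%C) by now rewrite Cmult_1_r in h.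
  apply (is_cderive_scal (- w) RtoC).
  split; simpl; [apply (is_derive_id (K := R_AbsRing)) | apply (is_derive_const (V := R_NormedModule))].
- replace (cexp w) with l; [exact Hl|].
  replace l with (l * cexp (- w * 1) * cexp w)%C.
  + rewrite He. replace (- w * 0)%C with (RtoC 0) by ring. rewrite cexp_0. simpl.
    replace (/ 1) with 1 by field. ring.
  + replace (- w * 1)%C with (- w)%C by ring.
    rewrite <- Cmult_assoc, (Cmult_comm (cexp (- w))), cexp_opp_r. ring.
Qed.

(** On the right half plane, where all logarithms below are taken, this removes the case distinction
    and the modulus from [carg] and leaves a form that is easy to differentiate. *)
Lemma carg_atan (z : C) : 0 < Re z -> carg z = atan (Im z / Re z).
Proof.
intros Hz.
assert (Hm : 0 < Cmod z) by (eapply Rlt_le_trans; [exact Hz | eapply Rle_trans; [apply Rle_abs | apply re_le_Cmod]]).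
unfold carg. rewrite acos_atan by now apply Rdiv_lt_0_compat.
replace (1 - (Re z / Cmod z)²) with ((Im z / Cmod z)²).
- replace (sqrt (Im z / Cmod z)² / (Re z / Cmod z)) with (Rabs (Im z) / Re z).
  2: { rewrite sqrt_Rsqr_abs, Rabs_div, (Rabs_pos_eq (Cmod z)) by lra. field. lra. }
  destruct (Rlt_dec (Im z) 0) as [h | h].
  + rewrite Rabs_left, <- atan_opp by easy. f_equal. field. lra.
  + rewrite Rabs_pos_eq by lra. reflexivity.
- unfold Rsqr. assert (h := Cmod2_alt z).
  transitivity (Im z ^ 2 / Cmod z ^ 2); [field; lra|].
  replace (Im z ^ 2) with (Cmod z ^ 2 - Re z ^ 2) by (rewrite h; ring).
  field. lra.
Qed.

Lemma ln_sqrt (y : R) : 0 < y -> ln (sqrt y) = / 2 * ln y.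
Proof.
intros Hy. rewrite <- (sqrt_sqrt y) at 2 by lra.
rewrite ln_mult by now apply sqrt_lt_R0. field.
Qed.

Lemma is_cderive_clog_line (x : C) (t : R) :
  0 < Re (1 + t * x)%C ->
  is_cderive (fun t => clog (1 + t * x)%C) t (x / (1 + t * x))%C.
Proof.
destruct x as [a b]. intros H.
assert (HRe : forall t : R, Re (1 + t * (a, b))%C = 1 + t * a) by (intros; unfold Re; simpl; ring).
assert (HIm : forall t : R, Im (1 + t * (a, b))%C = t * b) by (intros; unfold Im; simpl; ring).
rewrite HRe in H.
assert (Hloc : locally t (fun t => 0 < 1 + t * a)).
{ assert (Hc : continuous (fun t : R => 1 + t * a) t)
    by (apply (ex_derive_continuous (fun t : R => 1 + t * a)); auto_derive; easy).
  apply (Hc (fun y => 0 < y)). now apply open_gt. }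
assert (Hpos : forall t, 0 < 1 + t * a -> 0 < (1 + t * a) * (1 + t * a) + (t * b) * (t * b)) by (intros; nra).
assert (Hq : ((a, b) / (1 + t * (a, b)))%C =
   ((a * (1 + t * a) + b * (t * b)) / ((1 + t * a) * (1 + t * a) + (t * b) * (t * b)),
    (b * (1 + t * a) - a * (t * b)) / ((1 + t * a) * (1 + t * a) + (t * b) * (t * b)))).
{ specialize (Hpos t H).
  apply injective_projections; simpl; field; apply Rgt_not_eq;
  match goal with |- ?x > 0 => replace x with ((1 + t * a) * (1 + t * a) + (t * b) * (t * b)) by ring end; exact Hpos. }
rewrite Hq. split; simpl Re; simpl Im.
- apply (is_derive_ext_loc (fun t => / 2 * ln ((1 + t * a) * (1 + t * a) + (t * b) * (t * b)))).
  + revert Hloc. apply filter_imp. intros s Hs.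
    rewrite <- ln_sqrt by now apply Hpos. unfold Cmod. f_equal. f_equal.
    change (fst ?z) with (Re z). change (snd ?z) with (Im z). rewrite HRe, HIm. ring.
  + specialize (Hpos t H). auto_derive; [lra|]. unfold Re; simpl. field. lra.
- apply (is_derive_ext_loc (fun t => atan (t * b / (1 + t * a)))).
  + revert Hloc. apply filter_imp. intros s Hs.
    change (snd (clog (1 + s * (a, b))%C)) with (carg (1 + s * (a, b))%C).
    rewrite carg_atan; rewrite HRe; [now rewrite HIm | exact Hs].
  + specialize (Hpos t H). auto_derive; [lra|]. unfold Im; simpl. unfold Rsqr. field. nra.
Qed.

Lemma clog_1 : clog (RtoC 1) = RtoC 0.
Proof.
unfold clog. rewrite Cmod_1, ln_1, carg_atan by (simpl; lra).
simpl. replace (0 / 1) with 0 by field. now rewrite atan_0.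
Qed.

(** The coefficients c_k = (s)_k x^k / k! satisfy (k + 1) c_(k+1) = (s + k) x c_k. This is the
    recurrence of [pseries_linear_ode] with -x for x and s x for q, and E(t) = exp(s log(1 - t
    x)). *)
Lemma binomial_series (s x : C) :
  Cmod x < 1 ->
  Cis_series (fun k => poch s k * RtoC (/ INR (fact k)) * x ^ k)%C (cpower (1 - x) (- s)).
Proof.
intros Hx.
assert (Hx0 := Cmod_ge_0 x). assert (Hs0 := Cmod_ge_0 s).
assert (HRe : forall t, 0 <= t <= 1 -> 0 < Re (1 + t * (- x))%C).
{ intros t Ht. assert (h := Rle_trans _ _ _ (Rle_abs _) (re_le_Cmod x)).
  replace (Re (1 + t * - x)%C) with (1 - t * Re x) by (unfold Re; simpl; ring). nra. }
(* Any value strictly between |x| and 1 serves: rho = 1 / q exceeds 1 while |x| rho stays below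
   1. *)
set (q := (Cmod x + 1) / 2).
assert (Hq : 0 < q < 1) by (unfold q; lra).
assert (Hxq : 0 <= Cmod x / q < 1).
{ split; [apply Rmult_le_pos; [lra | apply Rlt_le, Rinv_0_lt_compat; lra]|].
  apply Rlt_div_l; unfold q; lra. }
assert (Hb := ex_series_binom_coef (Cmod s) _ Hs0 Hxq).
destruct (pseries_linear_ode (fun k => poch s k * RtoC (/ INR (fact k)) * x ^ k)%C (/ q)
  (Series (fun k => binom_coef (Cmod s) k * (Cmod x / q) ^ k)) (- x) (s * x)
  (fun t => cexp (s * clog (1 + t * (- x)))%C)
  (fun t => s * (- x / (1 + t * (- x))) * cexp (s * clog (1 + t * (- x))))%C) as (l & Hl & He).
- rewrite <- Rinv_1. apply Rinv_lt_contravar; lra.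
- intros n.
  eapply Rle_trans; [|apply (ex_series_term_le (fun k => binom_coef (Cmod s) k * (Cmod x / q) ^ k))].
  + rewrite !Cmod_mult, Cmod_pow, Cmod_R, Rabs_pos_eq
      by (apply Rlt_le, Rinv_0_lt_compat, INR_fact_pos).
    unfold Rdiv. rewrite Rpow_mult_distr, <- Rmult_assoc.
    apply Rmult_le_compat_r; [apply pow_le, Rlt_le, Rinv_0_lt_compat; lra|].
    apply Rmult_le_compat_r; [now apply pow_le|].
    apply Rmult_le_compat_r; [apply Rlt_le, Rinv_0_lt_compat, INR_fact_pos|].
    apply Cmod_poch_le; lra.
  + intros k. apply Rmult_le_pos; [now apply binom_coef_nonneg | now apply pow_le].
  + exact Hb.
- intros k. rewrite INR_fact_S, Rinv_mult, RtoC_mult. simpl poch. rewrite Cpow_S.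
  rewrite (RtoC_inv (INR (S k))) by (apply not_0_INR; lia).
  field. intros h. apply RtoC_inj in h. revert h. apply not_0_INR; lia.
- intros t Ht h. specialize (HRe t Ht). rewrite h in HRe. simpl in HRe. lra.
- intros t Ht. split.
  + apply is_cderive_cexp. apply is_cderive_scal. apply is_cderive_clog_line; auto.
  + field. intros h. specialize (HRe t Ht).
    rewrite h in HRe. simpl in HRe. lra.
- replace (cpower (1 - x) (- s)) with l; [exact Hl|].
  unfold cpower. replace (- s * clog (1 - x))%C with (- (s * clog (1 - x)))%C by ring.
  replace (1 + 1 * - x)%C with (1 - x)%C in He by ring.
  replace (1 + 0 * - x)%C with (RtoC 1) in He by ring.
  rewrite clog_1 in He. replace (s * 0)%C with (RtoC 0) in He by ring. rewrite cexp_0 in He.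
  transitivity (l * (cexp (s * clog (1 - x)) * cexp (- (s * clog (1 - x)))))%C.
  + rewrite cexp_opp_r. ring.
  + rewrite Cmult_assoc, He. simpl. replace (/ 1) with 1 by field. ring.
Qed.

(** * Majorized power series *)

(* The bound M on sum |a_k| r^k is what makes termwise sums of such functions
   summable again; d is the derivative at z0. *)
Definition majorized (f : C -> C) (z0 : C) (r M : R) (d : C) : Prop :=
  0 < r /\
  exists a : nat -> C,
    a 1%nat = d /\
    (forall n, sum_n (fun k => Cmod (a k) * r ^ k) n <= M) /\
    forall z, Cmod (z - z0)%C <= r -> Cis_series (fun k => a k * (z - z0) ^ k)%C (f z).

Lemma pseries_at_0 (a : nat -> C) (z : C) (l : C) :
  z = RtoC 0 -> Cis_series (fun k => a k * z ^ k)%C l -> l = a 0%nat.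
Proof.
intros -> H. apply (Cis_series_unique _ _ _ H).
replace (a 0%nat) with (a 0%nat * RtoC 0 ^ 0)%C by (simpl; ring).
apply (Cis_series_head (fun k => a k * RtoC 0 ^ k)%C).
intros n. rewrite Cpow_S. ring.
Qed.

Lemma Cmod_self_minus (z : C) : Cmod (z - z)%C = 0.
Proof. replace (z - z)%C with (RtoC 0) by ring. apply Cmod_0. Qed.

Lemma majorized_radius_pos f z0 r M d : majorized f z0 r M d -> 0 < r.
Proof. now intros [H _]. Qed.

Lemma coef_abs_nonneg (a : nat -> C) r k : 0 < r -> 0 <= Cmod (a k) * r ^ k.
Proof. intros Hr. apply Rmult_le_pos; [apply Cmod_ge_0 | apply pow_le; lra]. Qed.

Lemma majorized_bound_nonneg f z0 r M d : majorized f z0 r M d -> 0 <= M.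
Proof.
intros (Hr & a & _ & HM & _). eapply Rle_trans; [|apply (HM 0%nat)].
rewrite sum_O. now apply coef_abs_nonneg.
Qed.

Lemma majorized_le f z0 r M M' d : M <= M' -> majorized f z0 r M d -> majorized f z0 r M' d.
Proof.
intros h (Hr & a & Hd & HM & Hs). split; [easy|]. exists a. repeat split; auto.
intros n. eapply Rle_trans; [apply HM | exact h].
Qed.

Lemma majorized_shrink f z0 r r' M d : 0 < r' <= r -> majorized f z0 r M d -> majorized f z0 r' M d.
Proof.
intros h (Hr & a & Hd & HM & Hs). split; [easy|]. exists a. repeat split; auto.
- intros n. eapply Rle_trans; [|apply (HM n)]. apply sum_n_le_loc. intros k _.
  apply Rmult_le_compat_l; [apply Cmod_ge_0 | apply pow_incr; lra].
- intros z Hz. apply Hs. lra.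
Qed.

Lemma majorized_ext f g z0 r M d :
  (forall z, Cmod (z - z0)%C <= r -> f z = g z) -> majorized f z0 r M d -> majorized g z0 r M d.
Proof.
intros h (Hr & a & Hd & HM & Hs). split; [easy|]. exists a. repeat split; auto.
intros z Hz. rewrite <- h by easy. now apply Hs.
Qed.

Lemma majorized_const c z0 r : 0 < r -> majorized (fun _ => c) z0 r (Cmod c) (RtoC 0).
Proof.
intros Hr. split; [easy|].
exists (fun k => match k with O => c | _ => RtoC 0 end).
split; [easy|]. split.
- intros n. induction n as [|n IH].
  + rewrite sum_O. simpl. lra.
  + rewrite sum_Sn, Cmod_0. replace (0 * r ^ S n) with 0 by ring.
    change (sum_n (fun k => Cmod match k with O => c | _ => RtoC 0 end * r ^ k) n + 0 <= Cmod c).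
    lra.
- intros z _.
  generalize (Cis_series_head (fun k => match k with O => c | _ => RtoC 0 end * (z - z0) ^ k)%C).
  cbv beta iota. replace (c * (z - z0) ^ 0)%C with c by (simpl; ring).
  intros h; apply h. intros n. ring.
Qed.

Lemma majorized_plus f g z0 r M1 M2 d1 d2 :
  majorized f z0 r M1 d1 -> majorized g z0 r M2 d2 ->
  majorized (fun s => f s + g s)%C z0 r (M1 + M2) (d1 + d2)%C.
Proof.
intros (Hr & a & Hd & HM & Hs) (_ & b & Hd' & HM' & Hs'). split; [easy|].
exists (fun k => a k + b k)%C. split; [now rewrite Hd, Hd'|]. split.
- intros n. eapply Rle_trans; [|apply Rplus_le_compat; [apply (HM n) | apply (HM' n)]].
  rewrite <- (sum_n_plus (G := R_AbelianMonoid)). apply sum_n_le_loc. intros k _.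
  change (Cmod (a k + b k) * r ^ k <= Cmod (a k) * r ^ k + Cmod (b k) * r ^ k).
  rewrite <- Rmult_plus_distr_r. apply Rmult_le_compat_r; [apply pow_le; lra | apply Cmod_triangle].
- intros z Hz.
  apply (Cis_series_ext (fun k => a k * (z - z0) ^ k + b k * (z - z0) ^ k)%C);
    [intros; ring | apply Cis_series_plus; auto].
Qed.

Lemma Rsum_ext (a b : nat -> R) n : (forall k, a k = b k) -> sum_n a n = sum_n b n.
Proof. exact (sum_n_ext a b n). Qed.

Lemma sum_n_Rscal (c : R) (a : nat -> R) n : sum_n (fun k => c * a k) n = c * sum_n a n.
Proof. exact (sum_n_mult_l (K := R_Ring) c a n). Qed.

Lemma majorized_scal c f z0 r M d :
  majorized f z0 r M d -> majorized (fun s => c * f s)%C z0 r (Cmod c * M) (c * d)%C.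
Proof.
intros (Hr & a & Hd & HM & Hs). split; [easy|].
exists (fun k => c * a k)%C. split; [now rewrite Hd|]. split.
- intros n. rewrite (Rsum_ext _ (fun k => Cmod c * (Cmod (a k) * r ^ k)))
    by (intros; rewrite Cmod_mult; ring).
  rewrite sum_n_Rscal. apply Rmult_le_compat_l; [apply Cmod_ge_0 | apply HM].
- intros z Hz. apply (Cis_series_ext (fun k => c * (a k * (z - z0) ^ k))%C);
    [intros; ring | apply Cis_series_scal; auto].
Qed.

Lemma majorized_translate c f z0 r M d :
  majorized f (z0 + c)%C r M d -> majorized (fun s => f (s + c)%C) z0 r M d.
Proof.
intros (Hr & a & Hd & HM & Hs). split; [easy|]. exists a. repeat split; auto.
intros z Hz. replace (z - z0)%C with (z + c - (z0 + c))%C in * by ring. now apply Hs.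
Qed.

(** Writing s + c = (z0 + c) + (s - z0), the new coefficients are (z0 + c) a_k + a_(k-1); [b] is the
    shifted sequence. *)
Lemma majorized_lin c f z0 r M d :
  majorized f z0 r M d ->
  majorized (fun s => (s + c) * f s)%C z0 r ((Cmod (z0 + c)%C + r) * M) ((z0 + c) * d + f z0)%C.
Proof.
intros (Hr & a & Hd & HM & Hs). split; [easy|].
assert (Ha0 : f z0 = a 0%nat).
{ apply (pseries_at_0 a (z0 - z0)%C); [ring|]. apply Hs. rewrite Cmod_self_minus. lra. }
set (b := fun k => match k with O => RtoC 0 | S k => a k end).
assert (HM0 := Rle_trans _ _ _ (sum_n_nonneg _ 0 (fun k => coef_abs_nonneg a r k Hr)) (HM 0%nat)).
assert (Hb : forall n, sum_n (fun k => Cmod (b k) * r ^ k) n <= r * M).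
{ intros [|n].
  - rewrite sum_O. simpl. rewrite Cmod_0. nra.
  - unfold sum_n. rewrite sum_Sn_m, <- sum_n_m_S by lia. simpl b. rewrite Cmod_0.
    change (0 * r ^ 0 + sum_n (fun k => Cmod (a k) * (r * r ^ k)) n <= r * M).
    rewrite (Rsum_ext _ (fun k => r * (Cmod (a k) * r ^ k))) by (intros; ring).
    rewrite sum_n_Rscal. specialize (HM n). nra. }
exists (fun k => (z0 + c) * a k + b k)%C. split; [|split].
- simpl. now rewrite Hd, Ha0.
- intros n. rewrite Rmult_plus_distr_r.
  eapply Rle_trans; [|apply Rplus_le_compat; [|apply (Hb n)]].
  2: { apply Rmult_le_compat_l; [apply Cmod_ge_0 | apply (HM n)]. }
  rewrite <- sum_n_Rscal, <- (sum_n_plus (G := R_AbelianMonoid)). apply sum_n_le_loc. intros k _.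
  change (Cmod ((z0 + c) * a k + b k) * r ^ k
          <= Cmod (z0 + c) * (Cmod (a k) * r ^ k) + Cmod (b k) * r ^ k).
  rewrite <- Rmult_assoc, <- Cmod_mult, <- Rmult_plus_distr_r.
  apply Rmult_le_compat_r; [apply pow_le; lra | apply Cmod_triangle].
- intros z Hz. specialize (Hs z Hz).
  replace ((z + c) * f z)%C with ((z0 + c) * f z + (z - z0) * f z)%C by ring.
  apply (Cis_series_ext (fun k => (z0 + c) * (a k * (z - z0) ^ k) + b k * (z - z0) ^ k)%C);
    [intros; ring|].
  apply Cis_series_plus; [now apply Cis_series_scal|].
  replace ((z - z0) * f z)%C with
    ((z - z0) * f z + Csum (fun k => b k * (z - z0) ^ k) 0)%C
    by (rewrite Csum_0; simpl; ring).
  apply Cis_series_unshift.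
  apply (Cis_series_ext (fun k => (z - z0) * (a k * (z - z0) ^ k))%C).
  + intros k. change (1 + k)%nat with (S k). rewrite Cpow_S. simpl b. ring.
  + now apply Cis_series_scal.
Qed.

Lemma sum_n_RS (a : nat -> R) n : sum_n a (S n) = sum_n a n + a (S n).
Proof. exact (sum_Sn a n). Qed.

(** With w = z0 - c the coefficients of the quotient solve w b_k + b_(k-1) = a_k. Since r < |w|,
    this recurrence bounds the sum of |b_k| r^k by M / (|w| - r). *)
Lemma majorized_div c f z0 r M d :
  r < Cmod (z0 - c)%C ->
  majorized f z0 r M d ->
  exists d', majorized (fun s => f s / (s - c))%C z0 r (M / (Cmod (z0 - c)%C - r)) d'.
Proof.
intros Hrc (Hr & a & Hd & HM & Hs).
set (w := (z0 - c)%C) in *.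
assert (Hw : w <> RtoC 0) by (intros h; rewrite h, Cmod_0 in Hrc; lra).
set (b := (fix b k := match k with O => a 0%nat / w | S j => (a (S j) - b j) / w end)%C).
assert (Hb0 : (w * b 0%nat = a 0%nat)%C) by (simpl; now field).
assert (HbS : forall k, (w * b (S k) + b k = a (S k))%C)
  by (intros k; change (b (S k)) with ((a (S k) - b k) / w)%C; now field).
(* The contribution of the b_(k-1) runs only up to b_(n-1); the missing r |b_n| r^n is recorded on
   the right so that the induction closes. *)
assert (HB : forall n, (Cmod w - r) * sum_n (fun k => Cmod (b k) * r ^ k) n
   <= sum_n (fun k => Cmod (a k) * r ^ k) n - r * (Cmod (b n) * r ^ n)).
{ induction n as [|n IH].
  - rewrite !sum_O. simpl pow. rewrite <- Hb0, Cmod_mult. lra.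
  - rewrite !sum_n_RS.
    assert (h : Cmod w * Cmod (b (S n)) <= Cmod (a (S n)) + Cmod (b n)).
    { rewrite <- Cmod_mult. replace (w * b (S n))%C with (a (S n) + - b n)%C by (rewrite <- HbS; ring).
      eapply Rle_trans; [apply Cmod_triangle|]. rewrite Cmod_opp. lra. }
    assert (hr : 0 < r ^ S n) by (apply pow_lt; lra).
    apply (Rmult_le_compat_r (r ^ S n)) in h; [|lra].
    assert (e : Cmod (b n) * r ^ S n = r * (Cmod (b n) * r ^ n)) by (simpl; ring).
    lra. }
exists (b 1%nat). split; [easy|]. exists b. split; [easy|].
assert (HBM : forall n, sum_n (fun k => Cmod (b k) * r ^ k) n <= M / (Cmod w - r)).
{ intros n. apply Rle_div_r; [lra|]. specialize (HB n). specialize (HM n).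
  assert (h := coef_abs_nonneg b r n Hr). nra. }
split; [exact HBM|].
intros z Hz. specialize (Hs z Hz).
destruct (Cis_series_abs (fun k => b k * (z - z0) ^ k)%C (M / (Cmod w - r))) as (l & Hl & _).
{ intros n. eapply Rle_trans; [|apply (HBM n)]. apply sum_n_le_loc. intros k _.
  rewrite Cmod_mult, Cmod_pow. apply Rmult_le_compat_l; [apply Cmod_ge_0|].
  apply pow_incr. split; [apply Cmod_ge_0 | exact Hz]. }
assert (Hzc : (z - c)%C <> RtoC 0).
{ intros h. assert (e : w = (- (z - z0))%C) by (unfold w; replace z0 with (z - (z - z0))%C at 1 by ring;
    replace (z - (z - z0) - c)%C with ((z - c) - (z - z0))%C by ring; rewrite h; ring).
  rewrite e, Cmod_opp in Hrc. lra. }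
replace (f z / (z - c))%C with l; [exact Hl|].
assert (e : ((z - c) * l = f z)%C).
{ apply (Cis_series_unique (fun k => a k * (z - z0) ^ k)%C); [|exact Hs].
  replace ((z - c) * l)%C with ((z - z0) * l + w * (l - Csum (fun k => b k * (z - z0) ^ k) 0) + w * b 0%nat)%C
    by (rewrite Csum_0; unfold w; simpl pow; rewrite Cmult_1_r; ring).
  replace (w * b 0%nat)%C with (Csum (fun k => a k * (z - z0) ^ k) 0)%C
    by (rewrite Csum_0, Hb0; simpl; ring).
  apply Cis_series_unshift.
  apply (Cis_series_ext (fun k => (z - z0) * (b k * (z - z0) ^ k) + w * (b (1 + k)%nat * (z - z0) ^ (1 + k)))%C).
  - intros k. change (1 + k)%nat with (S k). rewrite <- HbS, Cpow_S. ring.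
  - apply Cis_series_plus; apply Cis_series_scal; [exact Hl|].
    apply (Cis_series_shift (fun k => b k * (z - z0) ^ k)%C l 0 Hl). }
rewrite <- e. now field.
Qed.

(** The k-th coefficient of F is the sum over n of the k-th coefficients of the f n, by interchange
    of summations. Its case k = 1 is termwise differentiation. *)
Lemma majorized_series (f : nat -> C -> C) (F : C -> C) z0 r (M : nat -> R) (d : nat -> C) :
  0 < r ->
  (forall n, majorized (f n) z0 r (M n) (d n)) ->
  ex_series M ->
  (forall z, Cmod (z - z0)%C <= r -> Cis_series (fun n => f n z) (F z)) ->
  exists D : C, Cis_series d D /\ majorized F z0 r (Series M) D.
Proof.
intros Hr Hf HMs HF.
destruct (choice (fun n (a : nat -> C) => a 1%nat = d n /\
    (forall N, sum_n (fun k => Cmod (a k) * r ^ k) N <= M n) /\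
    forall z, Cmod (z - z0)%C <= r -> Cis_series (fun k => a k * (z - z0) ^ k)%C (f n z)))
  as [a Ha]; [intros n; apply (Hf n)|].
assert (HM : forall n N, sum_n (fun k => Cmod (a n k * r ^ k)%C) N <= M n).
{ intros n N. destruct (Ha n) as (_ & h & _).
  rewrite (Rsum_ext _ (fun k => Cmod (a n k) * r ^ k)); [apply h|].
  intros k. rewrite Cmod_mult, <- RtoC_pow, Cmod_R, Rabs_pos_eq; [easy | apply pow_le; lra]. }
assert (HMpos : forall n, 0 <= M n) by (intros n; apply (majorized_bound_nonneg _ _ _ _ _ (Hf n))).
(* One coefficient is controlled by the whole row: |a n k| r^k <= M n. *)
assert (Hcol : forall k, exists A : C, Cis_series (fun n => a n k) A).
{ intros k. assert (hr : 0 < r ^ k) by (apply pow_lt; lra).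
  destruct (Cis_series_abs (fun n => a n k) (Series M / r ^ k)) as (l & Hl & _); [|now exists l].
  intros n. apply Rle_div_r; [exact hr|]. rewrite Rmult_comm, <- sum_n_Rscal.
  eapply Rle_trans; [|apply sum_n_le_is_series; [exact HMpos | apply Series_correct, HMs]].
  apply sum_n_le_loc. intros j _. eapply Rle_trans; [|apply (HM j k)].
  eapply Rle_trans; [|apply (term_le_sum_n (fun k => Cmod (a j k * r ^ k)%C)); intros; apply Cmod_ge_0].
  rewrite Cmod_mult, <- RtoC_pow, Cmod_R, Rabs_pos_eq by lra. lra. }
destruct (choice _ Hcol) as [A HA].
exists (A 1%nat). split.
{ apply (Cis_series_ext (fun n => a n 1%nat)); [intros n; apply (Ha n) | apply HA]. }
split; [easy|]. exists A. split; [easy|].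
assert (Hz : forall z, Cmod z <= r -> forall n N, sum_n (fun k => Cmod (a n k * z ^ k)%C) N <= M n).
{ intros z Hz n N. eapply Rle_trans; [|apply (HM n N)]. apply sum_n_le_loc. intros k _.
  rewrite !Cmod_mult, !Cmod_pow. apply Rmult_le_compat_l; [apply Cmod_ge_0|].
  apply pow_incr. split; [apply Cmod_ge_0|]. rewrite Cmod_R, Rabs_pos_eq; lra. }
split.
- intros n.
  rewrite (Rsum_ext _ (fun k => Cmod (A k * r ^ k)%C)).
  2: { intros k. rewrite Cmod_mult, <- RtoC_pow, Cmod_R, Rabs_pos_eq; [easy | apply pow_le; lra]. }
  apply (double_sum_bound (fun n k => a n k * r ^ k)%C M); [exact HM | exact HMs |].
  intros k. rewrite Cmult_comm.
  apply (Cis_series_ext (fun n => r ^ k * a n k)%C); [intros; ring|]. now apply Cis_series_scal.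
- intros z Hzr.
  apply (Cis_series_swap (fun n k => a n k * (z - z0) ^ k)%C M (fun n => f n z)).
  + now apply Hz.
  + exact HMs.
  + intros n. now apply (Ha n).
  + intros k. rewrite Cmult_comm.
    apply (Cis_series_ext (fun n => (z - z0) ^ k * a n k)%C); [intros; ring|]. now apply Cis_series_scal.
  + now apply HF.
Qed.

(** The derivative of (s)_k in s, by the product rule on the last factor. *)
Fixpoint dpoch (s : C) (k : nat) : C :=
  match k with
  | O => RtoC 0
  | S k => (poch s k + (s + INR k) * dpoch s k)%C
  end.

(** By [majorized_lin] each factor s + j multiplies the bound by |z0 + j| + r <= B + j. *)
Lemma majorized_poch f z0 r M d B k :
  Cmod z0 + r <= B ->
  majorized f z0 r M d ->
  majorized (fun s => poch s k * f s)%C z0 r (rpoch B k * M) (poch z0 k * d + dpoch z0 k * f z0)%C.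
Proof.
intros HB Hf. assert (Hr := majorized_radius_pos _ _ _ _ _ Hf).
assert (HM := majorized_bound_nonneg _ _ _ _ _ Hf).
assert (HB0 : 0 <= B) by (generalize (Cmod_ge_0 z0); lra).
induction k as [|k IH].
- simpl. replace (1 * d + 0 * f z0)%C with d by ring. replace (1 * M) with M by ring.
  apply (majorized_ext f); [intros; ring | exact Hf].
- apply (majorized_ext (fun s => (s + INR k) * (poch s k * f s))%C); [intros; simpl; ring|].
  generalize (majorized_lin (INR k) _ _ _ _ _ IH). simpl dpoch; simpl poch; simpl rpoch.
  match goal with |- majorized _ _ _ _ ?x -> majorized _ _ _ _ ?y => replace y with x by ring end.
  apply majorized_le.
  rewrite (Rmult_comm (rpoch B k) (B + INR k)), Rmult_assoc. apply Rmult_le_compat_r.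
  + apply Rmult_le_pos; [now apply rpoch_nonneg | exact HM].
  + generalize (Cmod_triangle z0 (INR k)). rewrite Cmod_INR. lra.
Qed.

(** For l = - ln n <= 0 the bound is n^(-(Re z0 - r)), the largest modulus of n^(-s) on the disc, so
    that passing to majorants costs nothing in the Dirichlet series. *)
Lemma majorized_cexp (l : R) z0 r :
  0 < r ->
  exists d, majorized (fun s => cexp (s * l)%C) z0 r (exp (Re z0 * l + r * Rabs l)) d.
Proof.
intros Hr. set (a := fun k => (cexp (z0 * l) * (RtoC l ^ k * RtoC (/ INR (fact k))))%C).
exists (a 1%nat). split; [easy|]. exists a. split; [easy|]. split.
- intros n.
  rewrite (Rsum_ext _ (fun k => exp (Re z0 * l) * (/ INR (fact k) * (r * Rabs l) ^ k))).
  + rewrite sum_n_Rscal, exp_plus. apply Rmult_le_compat_l; [apply Rlt_le, exp_pos|].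
    apply sum_exp_le. apply Rmult_le_pos; [lra | apply Rabs_pos].
  + intros k. unfold a. rewrite Cmod_mult, Cmod_pow_div_fact, Cmod_cexp, Cmod_R, re_scal_r, Rpow_mult_distr. ring.
- intros z _. unfold a.
  replace (cexp (z * l)) with (cexp (z0 * l) * cexp ((z - z0) * l))%C
    by (rewrite <- cexp_plus; f_equal; ring).
  apply (Cis_series_ext (fun k => cexp (z0 * l) * (((z - z0) * l) ^ k * RtoC (/ INR (fact k))))%C).
  + intros k. rewrite Cpow_mult_l. ring.
  + apply Cis_series_scal, cexp_series.
Qed.

(** The terms k >= 2 remain, and there |z - z0|^k <= |z - z0|^2 r^(k-2). *)
Lemma majorized_remainder f z0 r M d z :
  majorized f z0 r M d -> Cmod (z - z0)%C <= r ->
  Cmod (f z - f z0 - d * (z - z0))%C <= M / r ^ 2 * Cmod (z - z0)%C ^ 2.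
Proof.
intros (Hr & a & Hd & HM & Hs) Hz.
assert (Ha0 : f z0 = a 0%nat).
{ apply (pseries_at_0 a (z0 - z0)%C); [ring|]. apply Hs. rewrite Cmod_self_minus. lra. }
specialize (Hs z Hz). set (w := (z - z0)%C) in *.
apply (Cis_series_Cmod_le (fun k => a (2 + k)%nat * w ^ (2 + k))%C).
- intros N.
  apply Rle_trans with (sum_n (fun k => Cmod w ^ 2 / r ^ 2 * (Cmod (a (2 + k)%nat) * r ^ (2 + k))) N).
  + apply sum_n_le_loc. intros k _. rewrite Cmod_mult, Cmod_pow, !pow_add.
    replace (Cmod w ^ 2 / r ^ 2 * (Cmod (a (2 + k)%nat) * (r ^ 2 * r ^ k)))
      with (Cmod (a (2 + k)%nat) * (Cmod w ^ 2 * r ^ k)) by (field; lra).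
    apply Rmult_le_compat_l; [apply Cmod_ge_0|].
    apply Rmult_le_compat_l; [apply pow_le, Cmod_ge_0|].
    apply pow_incr. split; [apply Cmod_ge_0 | exact Hz].
  + rewrite sum_n_Rscal.
    replace (M / r ^ 2 * Cmod w ^ 2) with (Cmod w ^ 2 / r ^ 2 * M) by (field; lra).
    apply Rmult_le_compat_l.
    { apply Rmult_le_pos; [apply pow_le, Cmod_ge_0 | apply Rlt_le, Rinv_0_lt_compat, pow_lt, Hr]. }
    eapply Rle_trans; [|apply (HM (2 + N)%nat)].
    rewrite (Rsum_ext _ (fun k => Cmod (a (S (S k))) * r ^ (S (S k)))) by reflexivity.
    unfold sum_n. rewrite (sum_n_m_S (fun k => Cmod (a (S k)) * r ^ (S k)) 0 N).
    rewrite (sum_n_m_S (fun k => Cmod (a k) * r ^ k) 1 (S N)).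
    rewrite (sum_Sn_m _ 0) by lia. rewrite (sum_Sn_m _ 1) by lia.
    assert (h0 := coef_abs_nonneg a r 0 Hr). assert (h1 := coef_abs_nonneg a r 1 Hr).
    match goal with |- ?x <= plus ?y (plus ?z ?t) => change (x <= y + (z + x)) end. lra.
- replace (f z - f z0 - d * w)%C with (f z - Csum (fun k => a k * w ^ k) 1)%C
    by (rewrite Csum_S, Csum_0, Ha0, Hd; simpl; ring).
  apply (Cis_series_shift (fun k => a k * w ^ k)%C (f z) 1 Hs).
Qed.

Lemma majorized_C_derive f z0 r M d : majorized f z0 r M d -> C_derive f z0 = d.
Proof.
intros H. assert (Hr := majorized_radius_pos _ _ _ _ _ H).
assert (HM := majorized_bound_nonneg _ _ _ _ _ H).
apply is_C_lim_unique. apply filterlim_locally. intros eps.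
set (K := M / r ^ 2).
assert (HK : 0 <= K) by (apply Rmult_le_pos; [exact HM | apply Rlt_le, Rinv_0_lt_compat, pow_lt, Hr]).
(* The halving absorbs the factor sqrt 2 < 2 between balls and discs; K + 1 keeps the denominator
   positive when K = 0. *)
set (del := Rmin r (eps / (K + 1)) / 2).
assert (Hdel : 0 < del).
{ apply Rdiv_lt_0_compat; [|lra]. apply Rmin_pos; [exact Hr|].
  apply Rdiv_lt_0_compat; [apply cond_pos | lra]. }
exists (mkposreal _ Hdel). intros z Hz Hne.
apply C_NormedModule_mixin_compat1 with (eps := eps).
apply C_NormedModule_mixin_compat2 in Hz. change (minus z z0) with (z - z0)%C in Hz.
simpl in Hz.
assert (Hs2 : sqrt 2 < 2).
{ rewrite <- (sqrt_pow2 2) at 2 by lra. apply sqrt_lt_1; lra. }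
assert (Hz2 : Cmod (z - z0)%C < Rmin r (eps / (K + 1))) by (unfold del in *; nra).
assert (Hz3 := Rlt_le_trans _ _ _ Hz2 (Rmin_l _ _)).
assert (Hz4 := Rlt_le_trans _ _ _ Hz2 (Rmin_r _ _)).
assert (Hzz : (z - z0)%C <> RtoC 0) by now apply Cminus_eq_contra.
assert (Hpos := proj1 (Cmod_gt_0 _) Hzz).
change (Cmod ((f z - f z0) / (z - z0) - d)%C < eps).
replace ((f z - f z0) / (z - z0) - d)%C with ((f z - f z0 - d * (z - z0)) / (z - z0))%C by now field.
rewrite Cmod_div by easy.
apply Rlt_div_l; [exact Hpos|].
eapply Rle_lt_trans; [apply (majorized_remainder f z0 r M d z H); lra|]. fold K.
apply Rlt_div_r in Hz4; [|lra]. simpl. nra.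
Qed.

Lemma majorized_analytic f z0 r M d : majorized f z0 r M d -> analytic_at f z0.
Proof.
intros (Hr & a & _ & _ & Hs). exists a, r. split; [easy|]. intros z Hz.
apply (Cis_series_ext (fun k => a k * (z - z0) ^ k)%C).
- intros k. apply Cmult_comm.
- apply Hs. lra.
Qed.

(** * Identity theorem *)

(** Convergence at the single point z0 + r/2 makes the terms there eventually smaller than 1; at
    radius r/4 they are then dominated by a geometric series of ratio 1/2. *)
Lemma analytic_maj f z0 : analytic_at f z0 -> exists r M d, majorized f z0 r M d.
Proof.
intros (a & r & Hr & Hs).
assert (H1 : Cis_series (fun k => RtoC (r / 2) ^ k * a k)%C (f (z0 + RtoC (r / 2))%C)).
{ assert (e : (z0 + RtoC (r / 2) - z0)%C = RtoC (r / 2)) by ring.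
  generalize (Hs (z0 + RtoC (r / 2))%C). rewrite e, Cmod_R, Rabs_pos_eq by lra.
  intros h. exact (h ltac:(lra)). }
destruct (proj1 (Cis_series_eps _ _) H1 (1 / 2)) as [N HN]; [lra|].
set (p := (r / 4)).
assert (Hb : forall n, Cmod (a (S N + n)%nat) * p ^ (S N + n) <= (1 / 2) ^ n).
{ intros n. assert (h1 := HN (N + n)%nat ltac:(lia)). assert (h2 := HN (S (N + n)) ltac:(lia)).
  rewrite Csum_S in h2.
  set (u := Csum (fun k => (r / 2)%R ^ k * a k)%C (N + n)) in *.
  set (t := (RtoC (r / 2) ^ S (N + n) * a (S (N + n)))%C) in *.
  assert (ht : Cmod t < 1).
  { replace t with ((u + t - f (z0 + RtoC (r / 2))) + - (u - f (z0 + RtoC (r / 2))))%C by ring.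
    eapply Rle_lt_trans; [apply Cmod_triangle|]. rewrite Cmod_opp. lra. }
  unfold t in ht. rewrite Cmod_mult, Cmod_pow, Cmod_R, Rabs_pos_eq in ht by lra.
  replace p with (r / 2 * (1 / 2)) by (unfold p; field).
  change (S N + n)%nat with (S (N + n)). rewrite Rpow_mult_distr, <- Rmult_assoc.
  replace ((1 / 2) ^ n) with (1 * (1 / 2) ^ n) by ring.
  apply Rmult_le_compat; [apply Rmult_le_pos; [apply Cmod_ge_0 | apply pow_le; lra] | apply pow_le; lra | lra |].
  replace (S (N + n)) with (n + S N)%nat by lia. rewrite pow_add.
  assert (0 < (1/2) ^ n) by (apply pow_lt; lra).
  assert ((1/2) ^ S N <= 1 ^ S N) by (apply pow_incr; lra).
  rewrite pow1 in *. nra. }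
assert (Hex : ex_series (fun k => Cmod (a k) * p ^ k)).
{ apply (ex_series_incr_n (V := R_NormedModule) _ (S N)).
  apply (ex_series_le (V := R_CompleteNormedModule) _ (fun n => (1 / 2) ^ n)).
  - intros n. change (norm ?x) with (Rabs x). rewrite Rabs_pos_eq; [apply Hb|].
    apply Rmult_le_pos; [apply Cmod_ge_0 | apply pow_le; unfold p; lra].
  - apply ex_series_geom. rewrite Rabs_pos_eq; lra. }
exists p, (Series (fun k => Cmod (a k) * p ^ k)), (a 1%nat).
split; [unfold p; lra|]. exists a. split; [easy|]. split.
- intros n. apply sum_n_le_is_series; [|now apply Series_correct].
  intros k. apply coef_abs_nonneg. unfold p; lra.
- intros z Hz. apply (Cis_series_ext (fun k => (z - z0) ^ k * a k)%C); [intros; ring|].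
  apply Hs. unfold p in Hz; lra.
Qed.

(** All coefficients vanish by strong induction: if those before a_n do, a zero at distance |w| from
    z0 forces |a_n| <= K |w|, and |w| can be taken arbitrarily small. *)
Lemma majorized_zeros f z0 r M d :
  majorized f z0 r M d ->
  (forall del, 0 < del -> exists z, 0 < Cmod (z - z0)%C < del /\ f z = RtoC 0) ->
  forall z, Cmod (z - z0)%C <= r -> f z = RtoC 0.
Proof.
intros (Hr & a & _ & HM & Hs) Hacc.
assert (HM0 : 0 <= M) by
  (eapply Rle_trans; [apply (sum_n_nonneg _ 0 (fun k => coef_abs_nonneg a r k Hr)) | apply (HM 0%nat)]).
assert (Ha : forall n, a n = RtoC 0).
{ induction n as [n IH] using (well_founded_induction Nat.lt_wf_0).
  apply Cmod_lt_eps_eq0. intros eps He.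
  set (K := M / r ^ S n).
  assert (Hrn : 0 < r ^ S n) by (apply pow_lt, Hr).
  assert (HK : 0 <= K) by (apply Rmult_le_pos; [exact HM0 | apply Rlt_le, Rinv_0_lt_compat, Hrn]).
  destruct (Hacc (Rmin r (eps / (K + 1)))) as (z & [Hz1 Hz2] & Hz);
    [apply Rmin_pos; [exact Hr | apply Rdiv_lt_0_compat; lra]|].
  assert (Hz3 := Rlt_le_trans _ _ _ Hz2 (Rmin_l _ _)).
  assert (Hz4 := Rlt_le_trans _ _ _ Hz2 (Rmin_r _ _)).
  specialize (Hs z (Rlt_le _ _ Hz3)). rewrite Hz in Hs.
  set (w := (z - z0)%C) in *.
  assert (Hn : Csum (fun k => a k * w ^ k)%C n = (a n * w ^ n)%C).
  { destruct n as [|n]; [now rewrite Csum_0|]. rewrite Csum_S.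
    replace (Csum (fun k => a k * w ^ k)%C n) with (RtoC 0); [apply Cplus_0_l|].
    assert (IH' : forall j, (j <= n)%nat -> a j = RtoC 0) by (intros; apply IH; lia).
    clear -IH'. induction n as [|n IHn]; [rewrite Csum_0, IH' by lia; symmetry; apply Cmult_0_l|].
    rewrite Csum_S, <- IHn by (intros; apply IH'; lia). rewrite IH', Cmult_0_l by lia. symmetry; apply Cplus_0_l. }
  (* At a zero of f the n-th term is minus the tail of the series, which carries the factor
     |w|^(n+1). *)
  assert (Hle : Cmod (a n * w ^ n)%C <= K * Cmod w ^ S n).
  { rewrite <- Cmod_opp. rewrite <- Hn.
    replace (- Csum (fun k => a k * w ^ k) n)%C with (0 - Csum (fun k => a k * w ^ k) n)%C by ring.
    apply (Cis_series_Cmod_le (fun k => a (S n + k)%nat * w ^ (S n + k))%C);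
      [|apply (Cis_series_shift (fun k => a k * w ^ k)%C (RtoC 0) n Hs)].
    intros N.
    apply Rle_trans with (sum_n (fun k => Cmod w ^ S n / r ^ S n * (Cmod (a (S n + k)%nat) * r ^ (S n + k))) N).
    - apply sum_n_le_loc. intros k _. rewrite Cmod_mult, Cmod_pow, !pow_add.
      replace (Cmod w ^ S n / r ^ S n * (Cmod (a (S n + k)%nat) * (r ^ S n * r ^ k)))
        with (Cmod (a (S n + k)%nat) * (Cmod w ^ S n * r ^ k)) by (field; lra).
      apply Rmult_le_compat_l; [apply Cmod_ge_0|].
      apply Rmult_le_compat_l; [apply pow_le, Cmod_ge_0|].
      apply pow_incr. split; [apply Cmod_ge_0 | lra].
    - rewrite sum_n_Rscal. unfold K.
      replace (M / r ^ S n * Cmod w ^ S n) with (Cmod w ^ S n / r ^ S n * M) by (field; lra).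
      apply Rmult_le_compat_l.
      { apply Rmult_le_pos; [apply pow_le, Cmod_ge_0 | apply Rlt_le, Rinv_0_lt_compat, Hrn]. }
      eapply Rle_trans; [|apply (HM (S n + N)%nat)].
      unfold sum_n at 2. rewrite (sum_n_m_Chasles _ 0 n) by lia.
      assert (h := sum_n_nonneg _ n (fun k => coef_abs_nonneg a r k Hr)).
      replace (sum_n_m (fun k => Cmod (a k) * r ^ k) (S n) (S n + N))
        with (sum_n (fun k => Cmod (a (S n + k)%nat) * r ^ (S n + k)) N).
      + match goal with |- ?x <= plus ?y ?x => change (x <= y + x) end.
        change (sum_n_m _ 0 n) with (sum_n (fun k => Cmod (a k) * r ^ k) n). lra.
      + clear. induction N as [|N IH].
        * rewrite sum_O, Nat.add_0_r, sum_n_n. reflexivity.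
        * rewrite sum_Sn, IH, <- plus_n_Sm, sum_n_Sm by lia. reflexivity. }
  rewrite Cmod_mult, Cmod_pow in Hle. simpl pow in Hle.
  assert (Hwn : 0 < Cmod w ^ n) by now apply pow_lt.
  apply Rlt_div_r in Hz4; [|lra].
  assert (Hfin : Cmod (a n) <= K * Cmod w).
  { apply Rmult_le_reg_r with (Cmod w ^ n); [exact Hwn|]. lra. }
  lra. }
intros z Hz. apply (Cis_series_unique _ _ _ (Hs z Hz)).
apply (Cis_series_ext (fun _ => RtoC 0)); [intros k; rewrite Ha; ring|].
apply (Cis_series_head (fun _ => RtoC 0)). easy.
Qed.

(** The punctured plane is not convex, so the starting point depends on s. From 2 + i to a real s
    the segment meets the real axis only at s; from 2 to a non-real s it meets it only at 2. *)
Lemma segment_avoids_1 (s : C) :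
  s <> RtoC 1 ->
  exists p : C, 1 < Re p /\ forall t, 0 <= t <= 1 -> (p + RtoC t * (s - p))%C <> RtoC 1.
Proof.
intros Hs. destruct (Req_dec (Im s) 0) as [h | h].
- exists (2, 1). split; [simpl; lra|]. intros t Ht e.
  assert (e1 := f_equal Im e). assert (e2 := f_equal Re e). unfold Re, Im in *. simpl in *.
  destruct (Req_dec t 1) as [-> | Ht1]; [|nra].
  apply Hs. apply injective_projections; simpl; lra.
- exists (2, 0). split; [simpl; lra|]. intros t Ht e.
  assert (e1 := f_equal Im e). assert (e2 := f_equal Re e). unfold Re, Im in *. simpl in *.
  assert (t * snd s = 0) by lra. apply Rmult_integral in H. destruct H; [subst; lra | easy].
Qed.

Lemma Cmod_line (p q : C) (t u : R) :
  Cmod ((p + RtoC t * q) - (p + RtoC u * q))%C = Rabs (t - u) * Cmod q.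
Proof.
rewrite <- Cmod_R, <- Cmod_mult. f_equal. rewrite RtoC_minus. ring.
Qed.

(** Continuity method along a segment from the half plane Re > 1 to s: T is the supremum of the
    parameters up to which the difference h vanishes. *)
Lemma analytic_identity (f g : C -> C) :
  (forall s, s <> RtoC 1 -> analytic_at f s) ->
  (forall s, s <> RtoC 1 -> analytic_at g s) ->
  (forall s, 1 < Re s -> f s = g s) ->
  forall s, s <> RtoC 1 -> f s = g s.
Proof.
intros Hf Hg Heq s Hs.
set (h := fun z => (f z + - (1) * g z)%C).
enough (h s = RtoC 0) by (apply Ceq_minus; rewrite <- H; unfold h; ring).
assert (Hh : forall z, z <> RtoC 1 -> exists r M d, majorized h z r M d).
{ intros z Hz. destruct (analytic_maj _ _ (Hf z Hz)) as (r1 & M1 & d1 & H1).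
  destruct (analytic_maj _ _ (Hg z Hz)) as (r2 & M2 & d2 & H2).
  assert (hr1 := majorized_radius_pos _ _ _ _ _ H1). assert (hr2 := majorized_radius_pos _ _ _ _ _ H2).
  assert (hm := Rmin_pos _ _ hr1 hr2).
  eexists (Rmin r1 r2), _, _. apply majorized_plus.
  - eapply majorized_shrink; [split; [exact hm | apply Rmin_l] | exact H1].
  - eapply majorized_shrink; [split; [exact hm | apply Rmin_r] | apply majorized_scal, H2]. }
assert (H0 : forall z, 1 < Re z -> h z = RtoC 0).
{ intros z Hz. unfold h. rewrite Heq by easy. ring. }
clearbody h. clear f g Hf Hg Heq.
destruct (Rlt_le_dec 1 (Re s)) as [h1 | h1]; [now apply H0|].
destruct (segment_avoids_1 s Hs) as (p & Hp & Hray).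
set (q := (s - p)%C) in *.
assert (Hq : 0 < Cmod q).
{ apply Cmod_gt_0. intros e. assert (s = p) by now apply Ceq_minus. subst s. lra. }
set (gam := fun t => (p + RtoC t * q)%C) in *.
set (E := fun t => 0 <= t <= 1 /\ forall u, 0 <= u <= t -> h (gam u) = RtoC 0).
assert (HE0 : exists u0, 0 < u0 /\ E u0).
(* Up to u0 the real part drops by at most half of Re p - 1, so the segment stays in Re > 1. This
   gives T > 0. *)
{ set (u0 := Rmin 1 ((Re p - 1) / 2 / Cmod q)).
  assert (hu : 0 < u0) by (apply Rmin_pos; [lra | repeat apply Rdiv_lt_0_compat; lra]).
  exists u0. split; [exact hu|]. split; [split; [lra | apply Rmin_l]|].
  intros u Hu. apply H0. unfold gam.
  assert (hle : u * Cmod q <= (Re p - 1) / 2).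
  { apply Rle_div_r; [exact Hq|]. eapply Rle_trans; [apply Hu | apply Rmin_r]. }
  replace (Re (p + RtoC u * q)%C) with (Re p + u * Re q) by (unfold Re; simpl; ring).
  assert (hq := re_le_Cmod q). apply Rabs_le_between in hq. nra. }
destruct HE0 as (u0 & Hu0 & HEu0).
destruct (completeness E) as [T [HT1 HT2]].
{ exists 1. intros t [Ht _]. apply Ht. }
{ now exists u0. }
assert (HuT := HT1 u0 HEu0).
assert (HT : 0 <= T <= 1) by (split; [lra | apply HT2; intros t [Ht _]; apply Ht]).
assert (Hbelow : forall u, 0 <= u < T -> h (gam u) = RtoC 0).
{ intros u Hu. apply NNPP. intros hne.
  assert (T <= u); [|lra]. apply HT2. intros t [Ht Htu]. apply Rnot_lt_le. intros hlt.
  apply hne, Htu. lra. }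
destruct (Hh (gam T)) as (r & M & d & HM); [now apply Hray|].
assert (hr := majorized_radius_pos _ _ _ _ _ HM).
assert (Hdisc : forall z, Cmod (z - gam T)%C <= r -> h z = RtoC 0).
(* The points gam (T - v) with small v > 0 are zeros accumulating at gam T. *)
{ apply (majorized_zeros h (gam T) r M d HM). intros del Hdel.
  set (v := Rmin (T / 2) (del / 2 / Cmod q)).
  assert (hv : 0 < v) by (apply Rmin_pos; [lra | repeat apply Rdiv_lt_0_compat; lra]).
  assert (hv1 : v <= T / 2) by apply Rmin_l.
  assert (hv2 : v * Cmod q <= del / 2) by (apply Rle_div_r; [exact Hq | apply Rmin_r]).
  exists (gam (T - v)). split; [|apply Hbelow; lra].
  unfold gam. rewrite Cmod_line. replace (T - v - T) with (- v) by ring.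
  rewrite Rabs_Ropp, Rabs_pos_eq by lra. split; nra. }
assert (HT1' : T = 1).
(* If T < 1, the disc around gam T would carry the vanishing past T. *)
{ apply Rle_antisym; [apply HT|]. apply Rnot_lt_le. intros hlt.
  set (v := Rmin (1 - T) (r / Cmod q)).
  assert (hv : 0 < v) by (apply Rmin_pos; [lra | apply Rdiv_lt_0_compat; lra]).
  assert (hv1 : v <= 1 - T) by apply Rmin_l.
  assert (hv2 : v * Cmod q <= r) by (apply Rle_div_r; [exact Hq | apply Rmin_r]).
  assert (T + v <= T); [|lra]. apply HT1. split; [lra|]. intros u Hu.
  destruct (Rlt_le_dec u T) as [hu | hu]; [apply Hbelow; lra|].
  apply Hdisc. unfold gam. rewrite Cmod_line, Rabs_pos_eq by lra. nra. }
replace s with (gam T); [apply Hdisc; rewrite Cmod_self_minus; lra|].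
unfold gam, q. rewrite HT1'. ring.
Qed.

(** The bridge from the epsilon choice to any explicitly built continuation. *)
Lemma hurwitz_zeta_unique alpha (Z : C -> C) :
  is_hurwitz_zeta alpha Z ->
  forall s, s <> RtoC 1 -> hurwitz_zeta s alpha = Z s.
Proof.
intros HZ.
assert (H := epsilon_spec (inhabits (fun _ : C => RtoC 0)) (is_hurwitz_zeta alpha) (ex_intro _ Z HZ)).
destruct HZ as [HZ1 HZ2], H as [H1 H2].
apply (analytic_identity (fun s => hurwitz_zeta s alpha)); [exact H2 | exact HZ2 |].
intros s Hs. exact (Cis_series_unique _ _ _ (H1 s Hs) (HZ1 s Hs)).
Qed.

(** * Dirichlet series and their binomial expansion *)

(** Total by construction, so that continuations can be written as functions before their
    convergence is known. *)
Definition CSeries (u : nat -> C) : C :=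
  (Series (fun n => Re (u n)), Series (fun n => Im (u n))).

Lemma CSeries_unique (u : nat -> C) (l : C) : Cis_series u l -> CSeries u = l.
Proof.
intros H. apply Cis_series_re_im in H. destruct H as [H1 H2].
apply injective_projections; simpl; now apply is_series_unique.
Qed.

Lemma CSeries_correct (u : nat -> C) : (exists l, Cis_series u l) -> Cis_series u (CSeries u).
Proof. intros [l Hl]. now rewrite (CSeries_unique u l). Qed.

Lemma CSeries_ext (u v : nat -> C) : (forall n, u n = v n) -> CSeries u = CSeries v.
Proof.
intros H. unfold CSeries. f_equal; apply Series_ext; intros n; now rewrite H.
Qed.

(* x ^ (- s) for real x > 0. *)
Definition rpw (x : R) (s : C) : C := cexp (s * RtoC (- ln x))%C.

Lemma Cmod_rpw x s : Cmod (rpw x s) = exp (- (Re s * ln x)).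
Proof. unfold rpw. rewrite Cmod_cexp, re_scal_r. f_equal. ring. Qed.

Lemma rpw_plus x s t : rpw x (s + t) = (rpw x s * rpw x t)%C.
Proof. unfold rpw. rewrite <- cexp_plus. f_equal. ring. Qed.

Lemma rpw_INR x k : 0 < x -> rpw x (RtoC (INR k)) = RtoC ((/ x) ^ k).
Proof.
intros Hx. unfold rpw. rewrite <- RtoC_mult, cexp_RtoC. f_equal.
rewrite <- ln_Rinv by easy. rewrite <- Rpower_pow by now apply Rinv_0_lt_compat.
reflexivity.
Qed.

(** A positive real factor does not change the argument, so the principal branch is multiplicative
    here. *)
Lemma cpower_scal (x : R) (w s : C) :
  0 < x -> 0 < Re w -> cpower (RtoC x * w) (- s) = (rpw x s * cpower w (- s))%C.
Proof.
intros Hx Hw. unfold cpower, rpw. rewrite <- cexp_plus. f_equal.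
replace (clog (RtoC x * w)) with (RtoC (ln x) + clog w)%C.
- rewrite RtoC_opp. ring.
- assert (Hm : 0 < Cmod w) by (eapply Rlt_le_trans; [exact Hw | eapply Rle_trans; [apply Rle_abs | apply re_le_Cmod]]).
  unfold clog. rewrite Cmod_mult, Cmod_R, (Rabs_pos_eq x), ln_mult by lra.
  rewrite (carg_atan (RtoC x * w)) by (rewrite re_scal_l; nra).
  rewrite carg_atan by exact Hw. rewrite re_scal_l, im_scal_l.
  apply injective_projections; simpl; [ring|]. rewrite Rplus_0_l. f_equal. field. lra.
Qed.

Lemma cpower_RtoC x s : 0 < x -> cpower (RtoC x) (- s) = rpw x s.
Proof.
intros Hx. rewrite <- (Cmult_1_r x), cpower_scal by (simpl; lra).
unfold cpower. rewrite clog_1. replace (- s * 0)%C with (RtoC 0) by ring. rewrite cexp_0. ring.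
Qed.

Lemma exp_le x y : x <= y -> exp x <= exp y.
Proof. intros [h | ->]; [now apply Rlt_le, exp_increasing | apply Rle_refl]. Qed.

Lemma ln_nonneg x : 1 <= x -> 0 <= ln x.
Proof. intros H. rewrite <- ln_1. apply ln_le; lra. Qed.

Lemma INR_ge_1 n : (1 <= n)%nat -> 1 <= INR n.
Proof. intros H. apply (le_INR 1 n H). Qed.

(* Bernoulli's inequality turns the terms into a telescoping sum. *)
Lemma power_diff_ge (p : R) (n : nat) :
  1 < p -> (1 <= n)%nat ->
  (p - 1) * exp (- (p * ln (INR (S n))))
  <= exp (- ((p - 1) * ln (INR n))) - exp (- ((p - 1) * ln (INR (S n)))).
Proof.
intros Hp Hn.
assert (h1 := INR_ge_1 n Hn). assert (h2 : INR (S n) = INR n + 1) by apply S_INR.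
set (x := INR n) in *. rewrite h2.
assert (e1 : exp (- ((p - 1) * ln x))
  = exp (- ((p - 1) * ln (x + 1))) * exp ((p - 1) * (ln (x + 1) - ln x)))
  by (rewrite <- exp_plus; f_equal; ring).
assert (e2 : exp (- (p * ln (x + 1))) = exp (- ((p - 1) * ln (x + 1))) * / (x + 1)).
{ rewrite <- (exp_ln (x + 1)) at 3 by lra. rewrite <- exp_Ropp, <- exp_plus. f_equal. ring. }
rewrite e1, e2.
assert (h3 : 1 + (p - 1) * (ln (x + 1) - ln x) <= exp ((p - 1) * (ln (x + 1) - ln x))).
{ apply exp_ineq1_le. }
assert (h4 : / (x + 1) <= ln (x + 1) - ln x).
{ replace (ln (x + 1) - ln x) with (- ln (x / (x + 1))) by (rewrite ln_div by lra; ring).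
  assert (h := exp_ineq1_le (ln (x / (x + 1)))).
  rewrite exp_ln in h by (apply Rdiv_lt_0_compat; lra).
  replace (x / (x + 1)) with (1 - / (x + 1)) in h at 2 by (field; lra). lra. }
assert (h5 := exp_pos (- ((p - 1) * ln (x + 1)))).
set (y := exp (- ((p - 1) * ln (x + 1)))) in *.
apply (Rmult_le_compat_l (p - 1)) in h4; [|lra].
replace ((p - 1) * (y * / (x + 1))) with (y * ((p - 1) * / (x + 1))) by ring.
match goal with |- _ <= y * ?E - y => replace (y * E - y) with (y * (E - 1)) by ring end.
apply Rmult_le_compat_l; lra.
Qed.

Lemma ex_series_power (p : R) (N : nat) :
  1 < p -> (1 <= N)%nat -> ex_series (fun n => exp (- (p * ln (INR (n + N))))).
Proof.
intros Hp HN. apply (ex_series_incr_1 (V := R_NormedModule)).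
apply (ex_series_bounded _ (exp (- ((p - 1) * ln (INR N))) / (p - 1))).
{ intros; apply Rlt_le, exp_pos. }
intros n. apply Rle_div_r; [lra|].
enough (sum_n (fun k => exp (- (p * ln (INR (S k + N))))) n * (p - 1)
  <= exp (- ((p - 1) * ln (INR N))) - exp (- ((p - 1) * ln (INR (S n + N))))).
{ eapply Rle_trans; [exact H|]. generalize (exp_pos (- ((p - 1) * ln (INR (S n + N))))). lra. }
induction n as [|n IH].
- rewrite sum_O. rewrite Rmult_comm. apply (power_diff_ge p N Hp HN).
- rewrite sum_n_RS.
  assert (h := power_diff_ge p (S n + N) Hp ltac:(lia)).
  change (S (S n + N)) with (S (S n) + N)%nat in h. lra.
Qed.

(** For Re s > 1 this is zeta(s) when N = 1 and zeta(s) - 1 when N = 2. *)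
Definition dseries (N : nat) (s : C) : C := CSeries (fun n => rpw (INR (n + N)) s).

Definition rdseries (N : nat) (p : R) : R := Series (fun n => exp (- (p * ln (INR (n + N))))).

Lemma dseries_correct N s :
  (1 <= N)%nat -> 1 < Re s -> Cis_series (fun n => rpw (INR (n + N)) s) (dseries N s).
Proof.
intros HN Hs. apply CSeries_correct.
destruct (Cis_series_abs (fun n => rpw (INR (n + N)) s) (rdseries N (Re s))) as (l & Hl & _);
  [|now exists l].
intros n. rewrite (Rsum_ext _ (fun n => exp (- (Re s * ln (INR (n + N))))))
  by (intros; apply Cmod_rpw).
apply sum_n_le_is_series; [intros; apply Rlt_le, exp_pos|].
apply Series_correct, ex_series_power; easy.
Qed.

Lemma Re_minus_le_Cmod (z z0 : C) : Re z0 - Cmod (z - z0)%C <= Re z.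
Proof.
assert (h := re_le_Cmod (z - z0)%C). apply Rabs_le_between in h.
replace (Re (z - z0)%C) with (Re z - Re z0) in h by (unfold Re; simpl; ring). lra.
Qed.

Lemma majorized_dseries N z0 r :
  (1 <= N)%nat -> 0 < r -> 1 < Re z0 - r ->
  exists d, majorized (dseries N) z0 r (rdseries N (Re z0 - r)) d.
Proof.
intros HN Hr Hz0.
destruct (choice (fun n d => majorized (rpw (INR (n + N))) z0 r
  (exp (- ((Re z0 - r) * ln (INR (n + N))))) d)) as [d Hd].
{ intros n. destruct (majorized_cexp (- ln (INR (n + N))) z0 r Hr) as [d Hd]. exists d.
  assert (h := ln_nonneg _ (INR_ge_1 (n + N) ltac:(lia))).
  rewrite Rabs_Ropp, Rabs_pos_eq in Hd by exact h.
  replace (- ((Re z0 - r) * ln (INR (n + N))))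
    with (Re z0 * - ln (INR (n + N)) + r * ln (INR (n + N))) by ring.
  exact Hd. }
destruct (majorized_series (fun n => rpw (INR (n + N))) (dseries N) z0 r _ d Hr Hd) as (D & _ & HD).
- now apply ex_series_power.
- intros z Hz. apply dseries_correct; [easy|]. generalize (Re_minus_le_Cmod z z0). lra.
- now exists D.
Qed.

(** Each n >= N satisfies n^(-k) <= N^(-k). This is the source of the geometric decay in the
    expansion. *)
Lemma rdseries_shift N p k :
  (1 <= N)%nat -> 1 < p -> rdseries N (p + INR k) <= (/ INR N) ^ k * rdseries N p.
Proof.
intros HN Hp. unfold rdseries. rewrite <- Series_scal_l.
assert (HN1 := INR_ge_1 N HN).
apply Series_le.
- intros n. split; [apply Rlt_le, exp_pos|].
  replace (- ((p + INR k) * ln (INR (n + N)))) with (INR k * - ln (INR (n + N)) + - (p * ln (INR (n + N)))) by ring.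
  rewrite exp_plus. apply Rmult_le_compat_r; [apply Rlt_le, exp_pos|].
  rewrite <- Rpower_pow by (apply Rinv_0_lt_compat; lra).
  unfold Rpower. rewrite ln_Rinv by lra.
  apply exp_le. apply Rmult_le_compat_l; [apply pos_INR|].
  apply Ropp_le_contravar. apply ln_le; [lra|]. apply le_INR; lia.
- apply (ex_series_scal_l (V := R_NormedModule)). now apply ex_series_power.
Qed.

(** From K on, the disc around z0 + k lies in the half plane of convergence; the factor N^K in the
    constant C0 compensates for counting the decay from k = 0. *)
Lemma majorized_dseries_far N z0 r :
  (1 <= N)%nat -> 0 < r ->
  exists C0 K, 0 <= C0 /\ forall k, (K <= k)%nat ->
    exists d, majorized (dseries N) (z0 + RtoC (INR k))%C r (C0 * (/ INR N) ^ k) d.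
Proof.
intros HN Hr. assert (HN1 := INR_ge_1 N HN).
destruct (INR_unbounded (1 - (Re z0 - r))) as [K HK].
set (p := Re z0 - r + INR K).
assert (Hp : 1 < p) by (unfold p; lra).
exists (INR N ^ K * rdseries N p), K. split.
{ apply Rmult_le_pos; [apply pow_le; lra|].
  eapply Rle_trans; [|apply (sum_n_le_is_series (fun n => exp (- (p * ln (INR (n + N))))) _ 0)].
  - rewrite sum_O. apply Rlt_le, exp_pos.
  - intros; apply Rlt_le, exp_pos.
  - apply Series_correct. now apply ex_series_power. }
intros k Hk.
assert (Hk' : INR k = INR K + INR (k - K)) by (rewrite <- plus_INR; f_equal; lia).
assert (HRe : Re (z0 + RtoC (INR k))%C - r = p + INR (k - K)).
{ replace (Re (z0 + RtoC (INR k))%C) with (Re z0 + INR k) by (unfold Re; simpl; ring).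
  unfold p. lra. }
destruct (majorized_dseries N (z0 + RtoC (INR k))%C r HN Hr) as [d Hd].
{ rewrite HRe. generalize (pos_INR (k - K)). lra. }
exists d. revert Hd. apply majorized_le. rewrite HRe.
eapply Rle_trans; [apply rdseries_shift; easy|].
replace k with (K + (k - K))%nat at 2 by lia. rewrite pow_add.
replace (INR N ^ K * rdseries N p * ((/ INR N) ^ K * (/ INR N) ^ (k - K)))
  with ((INR N * / INR N) ^ K * ((/ INR N) ^ (k - K) * rdseries N p))
  by (rewrite Rpow_mult_distr; ring).
rewrite Rinv_r, pow1 by lra. lra.
Qed.

(* With h s = (s - 1) * dseries N s this is (s)_(k+1) x^(k+1) / (k+1)! times
   dseries N (s + k + 1), the last factor of the Pochhammer symbol cancelling the
   pole at s + k = 0. *)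
Definition term (x : C) (h : C -> C) (k : nat) (s : C) : C :=
  (x ^ S k * RtoC (/ INR (fact (S k))) * (poch s k * h (s + RtoC (INR (S k)))))%C.

Definition dterm (x : C) (h : C -> C) (k : nat) (s : C) : C :=
  (x ^ S k * RtoC (/ INR (fact (S k))) *
    (poch s k * C_derive h (s + RtoC (INR (S k))) + dpoch s k * h (s + RtoC (INR (S k)))))%C.

(** p is the number of initial terms left out. In the recursion for [hrec], p = 1 drops the term
    that would refer to h at the very point being defined. *)
Definition tsum (x : C) (h : C -> C) (p : nat) (s : C) : C :=
  CSeries (fun k => term x h (k + p) s).

Lemma Cmod_inv_fact k : Cmod (RtoC (/ INR (fact k))) = / INR (fact k).
Proof. rewrite Cmod_R. apply Rabs_pos_eq, Rlt_le, Rinv_0_lt_compat, INR_fact_pos. Qed.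

Lemma majorized_term x h k z0 r M d :
  majorized h (z0 + RtoC (INR (S k)))%C r M d ->
  majorized (term x h k) z0 r
    (Cmod x ^ S k * / INR (fact (S k)) * (rpoch (Cmod z0 + r) k * M)) (dterm x h k z0).
Proof.
intros H. unfold dterm. rewrite (majorized_C_derive _ _ _ _ _ H).
replace (Cmod x ^ S k * / INR (fact (S k))) with (Cmod (x ^ S k * RtoC (/ INR (fact (S k))))%C)
  by (rewrite Cmod_mult, Cmod_inv_fact, Cmod_pow; reflexivity).
apply (majorized_scal (x ^ S k * RtoC (/ INR (fact (S k))))%C (fun s => poch s k * h (s + RtoC (INR (S k))))%C).
apply (majorized_poch (fun s => h (s + RtoC (INR (S k)))%C)); [lra|].
now apply majorized_translate.
Qed.

(** Finitely many terms take whatever majorant h provides. Beyond K the formula for h holds on the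
    whole disc and yields the explicit bound G, a term of the convergent series of
    [ex_series_binom_coef] at |x| / N. *)
Lemma majorized_tsum x h N p z0 r :
  (1 <= N)%nat -> Cmod x < INR N -> 0 < r ->
  (forall s, 1 < Re s -> h s = ((s + - (1)) * dseries N s)%C) ->
  (forall k, (p <= k)%nat -> exists M d, majorized h (z0 + RtoC (INR (S k)))%C r M d) ->
  exists (M : R) (D : C), Cis_series (fun k => dterm x h (k + p) z0) D /\
    majorized (tsum x h p) z0 r M D /\
    forall s, Cmod (s - z0)%C <= r ->
      Cis_series (fun k => term x h (k + p) s) (tsum x h p s).
Proof.
intros HN Hx Hr Hh Hmaj.
assert (HN1 := INR_ge_1 N HN). assert (Hx0 := Cmod_ge_0 x).
set (B := Cmod z0 + r). assert (HB : 0 <= B) by (generalize (Cmod_ge_0 z0); unfold B; lra).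
destruct (majorized_dseries_far N z0 r HN Hr) as (C0 & K1 & HC0 & Hfar).
destruct (INR_unbounded (1 - (Re z0 - r))) as [K2 HK2].
set (K := (K1 + K2)%nat).
set (G := fun k => C0 * (binom_coef B (S k) * (Cmod x / INR N) ^ S k)).
destruct (choice (fun k M => majorized (term x h (k + p)) z0 r M (dterm x h (k + p) z0) /\
    ((K <= k)%nat -> M = G (k + p)%nat))) as [M HM].
{ intros k. destruct (Nat.le_gt_cases K k) as [h1 | h1].
  2: { destruct (Hmaj (k + p)%nat ltac:(lia)) as (M & d & Hd).
       eexists; split; [apply (majorized_term _ _ _ _ _ _ _ Hd) | lia]. }
  exists (G (k + p)%nat). split; [|easy].
  destruct (Hfar (S (k + p)) ltac:(lia)) as [d Hd].
  assert (Hl := majorized_lin (- (1)) _ _ _ _ _ Hd).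
  eapply majorized_ext in Hl; [|intros z Hz; symmetry; apply Hh].
  2: { assert (h2 := Re_minus_le_Cmod z (z0 + RtoC (INR (S (k + p))))).
       replace (Re (z0 + RtoC (INR (S (k + p))))%C) with (Re z0 + INR (S (k + p))) in h2
         by (unfold Re; simpl; ring).
       assert (INR K2 <= INR (S (k + p))) by (apply le_INR; unfold K in h1; lia). lra. }
  apply (majorized_term x) in Hl. revert Hl. apply majorized_le. fold B.
  unfold G, binom_coef. simpl rpoch.
  unfold Rdiv. rewrite Rpow_mult_distr.
  set (y := Cmod x ^ S (k + p)). set (f := / INR (fact (S (k + p)))). set (t := (/ INR N) ^ S (k + p)).
  assert (0 <= y) by now apply pow_le.
  assert (0 <= f) by (apply Rlt_le, Rinv_0_lt_compat, INR_fact_pos).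
  assert (0 <= t) by (apply pow_le, Rlt_le, Rinv_0_lt_compat; lra).
  assert (hp := rpoch_nonneg B (k + p) HB).
  (* The factor s - 1 of h, taken at s + (k + p) + 1, is s + (k + p); its bound completes
     [rpoch B (k + p)] to the next Pochhammer symbol. *)
  assert (hle : Cmod (z0 + RtoC (INR (S (k + p))) + - (1))%C + r <= B + INR (k + p)).
  { rewrite S_INR, RtoC_plus.
    replace (z0 + (INR (k + p) + 1) + - (1))%C with (z0 + INR (k + p))%C by ring.
    generalize (Cmod_triangle z0 (INR (k + p))). rewrite Cmod_INR. unfold B. lra. }
  replace (C0 * (rpoch B (k + p) * (B + INR (k + p)) * f * (y * t)))
    with (y * f * (rpoch B (k + p) * ((B + INR (k + p)) * (C0 * t)))) by ring.
  apply Rmult_le_compat_l; [now apply Rmult_le_pos|].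
  apply Rmult_le_compat_l; [exact hp|].
  apply Rmult_le_compat_r; [now apply Rmult_le_pos | exact hle]. }
assert (Hq : 0 <= Cmod x / INR N < 1).
{ split; [apply Rmult_le_pos; [lra | apply Rlt_le, Rinv_0_lt_compat; lra]|].
  apply Rlt_div_l; lra. }
assert (HMs : ex_series M).
{ apply (ex_series_incr_n (V := R_NormedModule) M K).
  apply (ex_series_ext (V := R_NormedModule) (fun k => G ((K + k) + p)%nat)).
  - intros k. symmetry. apply HM. lia.
  - apply (ex_series_scal_l (V := R_NormedModule) C0 (fun k => binom_coef B (S (K + k + p)) * (Cmod x / INR N) ^ S (K + k + p))).
    apply (ex_series_ext (V := R_NormedModule) (fun k => binom_coef B (S (K + p) + k)%nat * (Cmod x / INR N) ^ (S (K + p) + k))).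
    + intros k. replace (S (K + k + p)) with (S (K + p) + k)%nat by lia. reflexivity.
    + apply (ex_series_incr_n (V := R_NormedModule) (fun k => binom_coef B k * (Cmod x / INR N) ^ k) (S (K + p))).
      now apply ex_series_binom_coef. }
assert (Hconv : forall s, Cmod (s - z0)%C <= r ->
      Cis_series (fun k => term x h (k + p) s) (tsum x h p s)).
{ intros s Hs. apply CSeries_correct.
  destruct (Cis_series_abs (fun k => term x h (k + p) s) (Series M)) as (l & Hl & _); [|now exists l].
  intros n. eapply Rle_trans; [|apply (sum_n_le_is_series M (Series M) n)].
  - apply sum_n_le_loc. intros k _. destruct (HM k) as [(_ & a & _ & Ha & Hsa) _].
    apply (Cis_series_Cmod_le _ _ _) with (2 := Hsa s Hs).
    intros j. eapply Rle_trans; [|apply (Ha j)]. apply sum_n_le_loc. intros i _.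
    rewrite Cmod_mult, Cmod_pow. apply Rmult_le_compat_l; [apply Cmod_ge_0|].
    apply pow_incr. split; [apply Cmod_ge_0 | exact Hs].
  - intros k. destruct (HM k) as [Hk _]. apply (majorized_bound_nonneg _ _ _ _ _ Hk).
  - now apply Series_correct. }
destruct (majorized_series (fun k => term x h (k + p)) (tsum x h p) z0 r M
  (fun k => dterm x h (k + p) z0) Hr) as (D & HD1 & HD2).
- intros n. apply HM.
- exact HMs.
- exact Hconv.
- exists (Series M), D. easy.
Qed.

(** Each nu = n + N gives nu^(-s) (1 - x / nu)^(-s), expanded by the binomial series; the term 1
    cancels, and summing over n first produces the Dirichlet series at s + k + 1. The cancellation
    gains a power of nu, so Re s > 0 suffices although each half of the difference needs Re s >
    1. *)
Lemma binomial_swap x h N s :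
  (1 <= N)%nat -> Cmod x < INR N -> 0 < Re s ->
  (forall s, 1 < Re s -> h s = ((s + - (1)) * dseries N s)%C) ->
  exists T : C,
    Cis_series (fun n => cpower (RtoC (INR (n + N)) - x) (- s) - rpw (INR (n + N)) s)%C T /\
    Cis_series (fun k => term x h k s) T.
Proof.
intros HN Hx Hs Hh.
assert (HN1 := INR_ge_1 N HN). assert (Hx0 := Cmod_ge_0 x). assert (Hs0 := Cmod_ge_0 s).
assert (Hq : 0 <= Cmod x / INR N < 1).
{ split; [apply Rmult_le_pos; [lra | apply Rlt_le, Rinv_0_lt_compat; lra]|].
  apply Rlt_div_l; lra. }
assert (Hbin := proj1 (ex_series_incr_1 (V := R_NormedModule) _) (ex_series_binom_coef (Cmod s) _ Hs0 Hq)).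
assert (Hpos : forall k, 0 <= binom_coef (Cmod s) (S k) * (Cmod x / INR N) ^ S k).
{ intros k. apply Rmult_le_pos; [now apply binom_coef_nonneg | now apply pow_le]. }
set (b := fun k => (poch s k * RtoC (/ INR (fact k)) * x ^ k)%C).
set (Q := Series (fun k => binom_coef (Cmod s) (S k) * (Cmod x / INR N) ^ S k)).
assert (Hnu : forall n, INR N <= INR (n + N)) by (intros; apply le_INR; lia).
set (c := fun n k => (b (S k) * rpw (INR (n + N)) (s + RtoC (INR (S k))))%C).
(* With nu = n + N, the modulus of nu^(-s-k-1) is at most nu^(-Re s - 1) N^(-k); the factor N comes
   from N^(-k) = N * N^(-(k+1)). *)
set (M := fun n => INR N * Q * exp (- ((Re s + 1) * ln (INR (n + N))))).
set (row := fun n => (cpower (RtoC (INR (n + N)) - x) (- s) - rpw (INR (n + N)) s)%C).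
assert (HM : forall n K, sum_n (fun k => Cmod (c n k)) K <= M n).
{ intros n K. unfold M. specialize (Hnu n). set (nu := INR (n + N)) in *.
  apply Rle_trans with (sum_n (fun k => exp (- ((Re s + 1) * ln nu)) * INR N *
     (binom_coef (Cmod s) (S k) * (Cmod x / INR N) ^ S k)) K).
  + apply sum_n_le_loc. intros k _. unfold c, b. fold nu. fold nu.
    rewrite !Cmod_mult, Cmod_inv_fact, Cmod_pow, Cmod_rpw.
    replace (Re (s + RtoC (INR (S k)))%C) with (Re s + 1 + INR k) by (rewrite S_INR; unfold Re; simpl; ring).
    replace (- ((Re s + 1 + INR k) * ln nu)) with (- ((Re s + 1) * ln nu) + INR k * - ln nu) by ring.
    rewrite exp_plus.
    assert (he : exp (INR k * - ln nu) <= (/ INR N) ^ k).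
    { rewrite <- ln_Rinv by lra. change (Rpower (/ nu) (INR k) <= (/ INR N) ^ k).
      rewrite Rpower_pow by (apply Rinv_0_lt_compat; lra).
      apply pow_incr. split; [apply Rlt_le, Rinv_0_lt_compat; lra | apply Rinv_le_contravar; lra]. }
    unfold Rdiv at 1. rewrite Rpow_mult_distr. simpl ((/ INR N) ^ S k).
    replace (exp (- ((Re s + 1) * ln nu)) * INR N *
       (binom_coef (Cmod s) (S k) * (Cmod x ^ S k * (/ INR N * (/ INR N) ^ k))))
      with (binom_coef (Cmod s) (S k) * Cmod x ^ S k * (exp (- ((Re s + 1) * ln nu)) * (/ INR N) ^ k))
      by (field; lra).
    apply Rmult_le_compat.
    * apply Rmult_le_pos; [apply Rmult_le_pos; [apply Cmod_ge_0 | apply Rlt_le, Rinv_0_lt_compat, INR_fact_pos] | now apply pow_le].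
    * apply Rmult_le_pos; apply Rlt_le, exp_pos.
    * apply Rmult_le_compat_r; [now apply pow_le|].
      apply Rmult_le_compat_r; [apply Rlt_le, Rinv_0_lt_compat, INR_fact_pos|].
      apply Cmod_poch_le; lra.
    * apply Rmult_le_compat_l; [apply Rlt_le, exp_pos | exact he].
  + rewrite sum_n_Rscal.
    replace (INR N * Q * exp (- ((Re s + 1) * ln nu)))
      with (exp (- ((Re s + 1) * ln nu)) * INR N * Q) by ring.
    apply Rmult_le_compat_l; [apply Rmult_le_pos; [apply Rlt_le, exp_pos | lra]|].
    apply sum_n_le_is_series; [exact Hpos | now apply Series_correct].
}
assert (HMs : ex_series M).
{ apply (ex_series_scal_l (V := R_NormedModule)). apply ex_series_power; [lra | easy]. }
assert (Hrow : forall n, Cis_series (c n) (row n)).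
{ intros n. unfold row. specialize (Hnu n). set (nu := INR (n + N)) in *.
  assert (hnz : RtoC nu <> RtoC 0) by (intros e; apply RtoC_inj in e; lra).
  assert (hxn : Cmod (x / nu)%C < 1).
  { rewrite Cmod_div, Cmod_R, Rabs_pos_eq by (easy || lra). apply Rlt_div_l; lra. }
  replace (RtoC nu - x)%C with (RtoC nu * (1 - x / nu))%C by now field.
  rewrite cpower_scal; [|lra|].
  2: { replace (Re (1 - x / nu)%C) with (1 - Re (x / nu)%C) by (unfold Re; simpl; ring).
       generalize (Rle_trans _ _ _ (Rle_abs _) (re_le_Cmod (x / nu)%C)). lra. }
  set (c0 := fun k => (poch s k * RtoC (/ INR (fact k)) * (x / nu) ^ k)%C).
  apply (Cis_series_ext (fun k => rpw nu s * c0 (1 + k)%nat)%C).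
  + intros k. change (1 + k)%nat with (S k). unfold c, c0, b. fold nu. rewrite rpw_plus, rpw_INR by lra.
    unfold Cdiv. rewrite Cpow_mult_l, RtoC_pow, (RtoC_inv nu) by (intros e; lra). ring.
  + replace (rpw nu s * cpower (1 - x / nu) (- s) - rpw nu s)%C
      with (rpw nu s * (cpower (1 - x / nu) (- s) - Csum c0 0))%C.
    * apply Cis_series_scal, Cis_series_shift. now apply binomial_series.
    * rewrite Csum_0. unfold c0. simpl. replace (/ 1) with 1 by field. ring.
}
destruct (Cis_series_abs row (Series M)) as (T & HT & _).
{ intros n. eapply Rle_trans; [apply sum_n_le_loc; intros k _; exact (Cis_series_Cmod_le _ _ _ (HM k) (Hrow k))|].
  apply sum_n_le_is_series; [|now apply Series_correct].
  intros k. eapply Rle_trans; [apply (Cmod_ge_0 (row k))|].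
  exact (Cis_series_Cmod_le _ _ _ (HM k) (Hrow k)). }
exists T. split; [exact HT|].
apply (Cis_series_swap c M row _ T HM HMs Hrow); [|exact HT].
intros k.
  assert (hs : 1 < Re (s + RtoC (INR (S k)))%C).
  { replace (Re (s + RtoC (INR (S k)))%C) with (Re s + INR (S k)) by (unfold Re; simpl; ring).
    rewrite S_INR. generalize (pos_INR k). lra. }
  replace (term x h k s) with (b (S k) * dseries N (s + RtoC (INR (S k))))%C.
  + apply Cis_series_scal. now apply dseries_correct.
  + unfold term, b. rewrite Hh by exact hs. simpl poch. rewrite S_INR, RtoC_plus. ring.
Qed.

Lemma rpw_telescope s :
  0 < Re s -> Cis_series (fun n => rpw (INR (n + 1)) s - rpw (INR (n + 2)) s)%C (RtoC 1).
Proof.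
intros Hs. apply Cis_series_eps. intros eps He.
(* The n-th partial sum is 1 - (n + 2)^(-s), whose distance to 1 is below eps once n + 2 exceeds
   eps^(-1 / Re s). *)
destruct (INR_unbounded (exp (- ln eps / Re s))) as [K HK].
exists K. intros n Hn.
assert (e : Csum (fun n => rpw (INR (n + 1)) s - rpw (INR (n + 2)) s)%C n
  = (1 - rpw (INR (n + 2)) s)%C).
{ assert (h1 : rpw (INR 1) s = RtoC 1).
  { unfold rpw. simpl INR. rewrite ln_1, Ropp_0, Cmult_0_r. apply cexp_0. }
  clear -h1. induction n as [|n IH].
  - rewrite Csum_0, <- h1. reflexivity.
  - rewrite Csum_S, IH. replace (S n + 1)%nat with (n + 2)%nat by lia.
    match goal with |- ?l = ?r => change (@eq C l r) end. ring. }
rewrite e. replace (1 - rpw (INR (n + 2)) s - 1)%C with (- rpw (INR (n + 2)) s)%C by ring.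
rewrite Cmod_opp, Cmod_rpw.
rewrite <- (exp_ln eps He). apply exp_increasing.
assert (h : - ln eps / Re s < ln (INR (n + 2))).
{ rewrite <- (ln_exp (- ln eps / Re s)). apply ln_increasing; [apply exp_pos|].
  eapply Rlt_le_trans; [exact HK|]. apply le_INR; lia. }
apply Rlt_div_l in h; [|exact Hs]. lra.
Qed.

(** * Entire continuation of (s - 1)(zeta s - 1) *)

Lemma Re_plus_R (s : C) (x : R) : Re (s + RtoC x)%C = Re s + x.
Proof. reflexivity. Qed.

Lemma Re_minus_1 (s : C) : Re (s - 1)%C = Re s - 1.
Proof. reflexivity. Qed.

Lemma term_ext x h h' k s :
  h (s + RtoC (INR (S k)))%C = h' (s + RtoC (INR (S k)))%C -> term x h k s = term x h' k s.
Proof. intros H. unfold term. now rewrite H. Qed.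

(* hrec n is the continuation to Re s > 1 - n. *)
Fixpoint hrec (n : nat) (s : C) : C :=
  match n with
  | O => ((s + - (1)) * dseries 2 s)%C
  | S n => (1 - tsum 1 (hrec n) 1 (s - 1))%C
  end.

Lemma term_1_0 h s : term 1 h 0 (s - 1)%C = h s.
Proof.
unfold term. simpl. replace (s - 1 + 1)%C with s by ring. replace (/ 1) with 1 by field. ring.
Qed.

(** The full expansion is used at s - 1, where the real part is only positive. Its term k = 0 is
    h(s) itself, and moving that term across the equation gives the recursion. *)
Lemma hrec_1 s : 1 < Re s -> hrec 1 s = hrec 0 s.
Proof.
intros Hs. simpl hrec at 1.
assert (H : Cis_series (fun k => term 1 (hrec 0) k (s - 1)%C) (RtoC 1)).
{ destruct (binomial_swap 1 (hrec 0) 2 (s - 1)%C) as (T & HT & H);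
    [lia | rewrite Cmod_1; simpl; lra | rewrite Re_minus_1; lra | easy |].
  enough (e : T = RtoC 1) by (rewrite e in H; exact H).
  apply (Cis_series_unique _ _ _ HT).
  apply (Cis_series_ext (fun n => rpw (INR (n + 1)) (s - 1) - rpw (INR (n + 2)) (s - 1))%C).
  - intros n. f_equal. rewrite <- RtoC_minus.
    replace (INR (n + 2) - 1) with (INR (n + 1)) by (rewrite !plus_INR; simpl; ring).
    symmetry. apply cpower_RtoC. rewrite plus_INR. generalize (pos_INR n). simpl. lra.
  - apply rpw_telescope. rewrite Re_minus_1; lra. }
apply (Cis_series_shift _ _ 0) in H. rewrite Csum_0, term_1_0 in H.
unfold tsum. rewrite (CSeries_ext _ (fun k => term 1 (hrec 0) (1 + k) (s - 1)%C))
  by (intros k; f_equal; lia).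
rewrite (CSeries_unique _ _ H). change (hrec 0 s) with ((s + - (1)) * dseries 2 s)%C. ring.
Qed.

Lemma tsum_ext x h h' p s :
  (forall k, (p <= k)%nat -> h (s + RtoC (INR (S k)))%C = h' (s + RtoC (INR (S k)))%C) ->
  tsum x h p s = tsum x h' p s.
Proof.
intros H. apply CSeries_ext. intros k. apply term_ext, H. lia.
Qed.

(** Values on the original half plane, analyticity and agreement of consecutive stages are proved
    together: stage n + 1 at s uses stage n only at s + k with k >= 1, one unit further to the
    right. *)
Lemma hrec_spec n :
  (forall s, 1 < Re s -> hrec n s = hrec 0 s) /\
  (forall z0 r, 0 < r -> 1 - INR n < Re z0 - r -> exists M d, majorized (hrec n) z0 r M d) /\
  (forall s, 1 - INR n < Re s -> hrec (S n) s = hrec n s).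
Proof.
induction n as [|n (IH1 & IH2 & IH3)].
- split; [easy|]. split.
  + intros z0 r Hr Hz. simpl in Hz.
    destruct (majorized_dseries 2 z0 r) as [d Hd]; [lia | easy | lra |].
    eexists _, _. apply (majorized_lin (- (1)) _ _ _ _ _ Hd).
  + intros s Hs. simpl INR in Hs. apply hrec_1. lra.
- rewrite S_INR. split; [|split].
  + intros s Hs. rewrite IH3; [now apply IH1|]. generalize (pos_INR n). lra.
  + intros z0 r Hr Hz.
    destruct (majorized_tsum 1 (hrec n) 2 1 (z0 - 1)%C r) as (M & D & _ & H & _).
    * lia.
    * rewrite Cmod_1. simpl. lra.
    * exact Hr.
    * exact IH1.
    * intros k Hk. apply IH2; [exact Hr|]. rewrite Re_plus_R, Re_minus_1, S_INR.
      apply INR_ge_1 in Hk. lra.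
    * apply (majorized_translate (- (1))%C (tsum 1 (hrec n) 1) z0) in H.
      eexists _, _. apply (majorized_ext (fun s => 1 + - (1) * tsum 1 (hrec n) 1 (s + - (1)))%C); [intros; simpl; unfold Cminus; ring|]. apply (majorized_plus (fun _ => RtoC 1) (fun s => - (1) * tsum 1 (hrec n) 1 (s + - (1)))%C).
      -- now apply majorized_const.
      -- apply majorized_scal. exact H.
  + intros s Hs. change (hrec (S (S n)) s) with (1 - tsum 1 (hrec (S n)) 1 (s - 1))%C.
    rewrite (tsum_ext _ _ (hrec n)); [reflexivity|]. intros k Hk. apply IH3.
    rewrite Re_plus_R, Re_minus_1, S_INR. apply INR_ge_1 in Hk. lra.
Qed.

Lemma hrec_stable n m s : (n <= m)%nat -> 1 - INR n < Re s -> hrec m s = hrec n s.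
Proof.
intros Hnm Hs. induction Hnm as [|m Hnm IH]; [easy|].
rewrite <- IH. apply hrec_spec. apply le_INR in Hnm. lra.
Qed.

(* The entire function (s - 1) (zeta s - 1). *)
Definition hent (s : C) : C :=
  hrec (epsilon (inhabits O) (fun n => 1 - INR n < Re s)) s.

Lemma hent_hrec n s : 1 - INR n < Re s -> hent s = hrec n s.
Proof.
intros Hn. unfold hent.
assert (H := epsilon_spec (inhabits O) (fun n => 1 - INR n < Re s) (ex_intro _ n Hn)).
set (m := epsilon _ _) in *. cbv beta in H.
destruct (Nat.le_ge_cases n m) as [h | h]; [now apply hrec_stable | symmetry; now apply hrec_stable].
Qed.

Lemma majorized_hent z0 r : 0 < r -> exists M d, majorized hent z0 r M d.
Proof.
intros Hr. destruct (INR_unbounded (1 - (Re z0 - r))) as [n Hn].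
destruct (hrec_spec n) as (_ & H & _).
destruct (H z0 r Hr ltac:(lra)) as (M & d & Hd). exists M, d. revert Hd. apply majorized_ext.
intros z Hz. symmetry. apply hent_hrec. generalize (Re_minus_le_Cmod z z0). lra.
Qed.

Lemma hent_dseries s : 1 < Re s -> hent s = ((s + - (1)) * dseries 2 s)%C.
Proof. intros Hs. apply (hent_hrec 0). simpl. lra. Qed.

Lemma hent_rec s : hent s = (1 - tsum 1 hent 1 (s - 1))%C.
Proof.
destruct (INR_unbounded (1 - Re s)) as [n Hn].
rewrite (hent_hrec (S n)) by (rewrite S_INR; lra).
change (hrec (S n) s) with (1 - tsum 1 (hrec n) 1 (s - 1))%C.
rewrite (tsum_ext _ _ hent); [reflexivity|]. intros k Hk. symmetry. apply hent_hrec.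
rewrite Re_plus_R, Re_minus_1, S_INR. generalize (pos_INR k). lra.
Qed.

(** * Pochhammer symbols at zeros, and the value and derivative of [hent] at 1 *)

Lemma poch_neg_zero m k : (m < k)%nat -> poch (- RtoC (INR m)) k = RtoC 0.
Proof.
induction k as [|k IH]; intros H; [lia|]. simpl.
destruct (Nat.eq_dec m k) as [-> | h]; [ring | rewrite IH by lia; ring].
Qed.

(** At s = -m only the factor s + m vanishes; the derivative is the product of the others, (-m)_m
    before it and 1 * 2 * ... * j after it. *)
Lemma dpoch_neg m j :
  dpoch (- RtoC (INR m)) (S m + j) = (poch (- RtoC (INR m)) m * RtoC (INR (fact j)))%C.
Proof.
induction j as [|j IH].
- rewrite Nat.add_0_r. simpl. ring.
- rewrite <- plus_n_Sm. change (dpoch ?s (S ?k)) with (poch s k + (s + INR k) * dpoch s k)%C.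
  rewrite poch_neg_zero, IH by lia. rewrite INR_fact_S, RtoC_mult.
  replace (INR (S m + j)) with (INR m + INR (S j)) by (rewrite <- plus_INR; f_equal; lia).
  rewrite RtoC_plus. ring.
Qed.

Lemma CSeries_0 (u : nat -> C) : (forall n, u n = RtoC 0) -> CSeries u = RtoC 0.
Proof.
intros H. rewrite (CSeries_ext u (fun _ => RtoC 0) H). apply CSeries_unique.
apply (Cis_series_head (fun _ => RtoC 0)). easy.
Qed.

Lemma poch_0_S k : poch (RtoC 0) (S k) = RtoC 0.
Proof.
replace (RtoC 0) with (- RtoC (INR 0))%C at 1 by (simpl; ring). apply poch_neg_zero. lia.
Qed.

Lemma dpoch_0_S k : dpoch (RtoC 0) (S k) = RtoC (INR (fact k)).
Proof.
replace (RtoC 0) with (- RtoC (INR 0))%C at 1 by (simpl; ring).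
change (S k) with (1 + k)%nat. rewrite (dpoch_neg 0 k). simpl. ring.
Qed.

Lemma hent_1 : hent (RtoC 1) = RtoC 1.
Proof.
rewrite hent_rec. replace (1 - 1)%C with (RtoC 0) by ring.
unfold tsum. rewrite CSeries_0; [ring|]. intros k. unfold term.
rewrite Nat.add_1_r, poch_0_S. ring.
Qed.

(** The recursion is differentiated at s = 1, where (s - 1)_(k+1) vanishes with derivative k!. Since
    h(k + 2) = (k + 1) (zeta(k + 2) - 1), this reads -h'(1) = sum over j >= 2 of (zeta(j) - 1) /
    j. *)
Lemma hent_series_derive :
  Cis_series (fun k => RtoC (/ INR (k + 2)) * dseries 2 (RtoC (INR (k + 2))))%C
    (- C_derive hent (RtoC 1))%C.
Proof.
destruct (majorized_tsum 1 hent 2 1 (RtoC 0) 1) as (M & D & HD & HM & _).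
- lia.
- rewrite Cmod_1; simpl; lra.
- lra.
- exact hent_dseries.
- intros k _. apply majorized_hent. lra.
- assert (e : C_derive hent (RtoC 1) = (- D)%C).
  { apply (majorized_C_derive hent (RtoC 1) 1 (Cmod 1 + Cmod (- (1)) * M)).
    replace (- D)%C with (0 + - (1) * D)%C by ring.
    apply (majorized_ext (fun s => 1 + - (1) * tsum 1 hent 1 (s + - (1)))%C).
    - intros z _. rewrite (hent_rec z). unfold Cminus. ring.
    - apply (majorized_plus (fun _ => RtoC 1) (fun s => - (1) * tsum 1 hent 1 (s + - (1)))%C);
        [apply majorized_const; lra|].
      apply majorized_scal. apply (majorized_translate (- (1))%C (tsum 1 hent 1)).
      replace (1 + - (1))%C with (RtoC 0) by ring. exact HM. }
  rewrite e. replace (- - D)%C with D by ring.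
  revert HD. apply Cis_series_ext. intros k. unfold dterm.
  rewrite Nat.add_1_r, poch_0_S, dpoch_0_S, hent_dseries.
  2: { rewrite Re_plus_R, S_INR, S_INR. simpl. generalize (pos_INR k). lra. }
  replace (0 + RtoC (INR (S (S k))))%C with (RtoC (INR (k + 2)))
    by (rewrite Cplus_0_l; do 2 f_equal; lia).
  rewrite Cpow_1_l, !INR_fact_S. replace (k + 2)%nat with (S (S k)) by lia.
  rewrite !Rinv_mult, !RtoC_mult.
  rewrite (S_INR (S k)) at 2 3. rewrite (S_INR (S k)), RtoC_plus.
  assert (h1 := INR_fact_pos k). assert (h2 := pos_INR k).
  rewrite (RtoC_inv (INR (fact k))), (RtoC_inv (INR (S k))) by (rewrite ?S_INR; lra).
  field. split; intros h; apply RtoC_inj in h; rewrite ?S_INR in h; lra.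
Qed.

(** * The value gamma *)

(** The power series of t^k / k and ln(1 - t) have opposite derivatives; the terms k = 0 and k = 1
    are then removed. *)
Lemma ln_series x : 0 < x < 1 ->
  is_series (fun k => / INR (k + 2) * x ^ (k + 2)) (- ln (1 - x) - x).
Proof.
intros Hx.
set (a := fun k => match k with O => 0 | S _ => / INR k end).
assert (Ha : forall t, 0 <= t <= x -> Rbar_lt (Rabs t) (CV_radius a)).
{ intros t Ht. apply (Rbar_lt_le_trans _ 1); [simpl; rewrite Rabs_pos_eq; lra|].
  apply (proj1 (CV_radius_bounded a)). exists 1. intros n.
  rewrite pow1, Rmult_1_r. destruct n as [|n]; [simpl; rewrite Rabs_R0; lra|].
  unfold a. rewrite S_INR. assert (h := pos_INR n). rewrite Rabs_pos_eq.
  - rewrite <- Rinv_1. apply Rinv_le_contravar; lra.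
  - apply Rlt_le, Rinv_0_lt_compat; lra. }
assert (E : PSeries a 0 + ln (1 - 0) = PSeries a x + ln (1 - x)).
{ apply (eq_is_derive (fun t => PSeries a t + ln (1 - t)) 0 x); [|lra].
  intros t Ht.
  evar_last.
  - apply (is_derive_plus (V := R_NormedModule) (PSeries a) (fun t => ln (1 - t))).
    + now apply is_derive_PSeries, Ha.
    + instantiate (1 := - / (1 - t)). auto_derive; [lra|]. field. lra.
  - replace (PSeries (PS_derive a) t) with (/ (1 - t)); [apply Rplus_opp_r|].
    symmetry. apply is_series_unique. apply (is_series_ext (fun k => t ^ k)).
    + intros k. unfold PS_derive, a. rewrite Rinv_r by (apply not_0_INR; lia). symmetry; apply Rmult_1_l.
    + apply is_series_geom. rewrite Rabs_pos_eq; lra. }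
rewrite PSeries_0, Rminus_0_r, ln_1 in E. simpl in E.
assert (H : is_series (fun k => a k * x ^ k) (- ln (1 - x))).
{ replace (- ln (1 - x)) with (PSeries a x) by lra.
  apply is_pseries_R, PSeries_correct, CV_radius_inside, Ha. lra. }
apply (is_series_ext (fun k => a (2 + k)%nat * x ^ (2 + k))).
- intros k. rewrite (Nat.add_comm k 2). reflexivity.
- apply (is_series_incr_n (V := R_NormedModule) (fun k => a k * x ^ k) 2); [lia|].
  replace (plus _ _) with (- ln (1 - x)); [exact H|].
  simpl Init.Nat.pred. rewrite sum_n_RS, sum_O. unfold a.
  change (- ln (1 - x) = - ln (1 - x) - x + (0 * x ^ 0 + / INR 1 * x ^ 1)). simpl. field.
Qed.

Lemma inv_sum_S n : inv_sum 1 (S n) = inv_sum 1 n + / INR (S n).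
Proof. unfold inv_sum. rewrite sum_n_Sm by lia. reflexivity. Qed.

(** Interchanging summations turns the sum of (zeta(j) - 1) / j into the sum over n >= 2 of -ln(1 -
    1/n) - 1/n, whose partial sums telescope to ln n - H_n + 1, with H_n the harmonic numbers. *)
Lemma C_derive_hent_1 : C_derive hent (RtoC 1) = RtoC (euler_gamma - 1).
Proof.
set (x := fun n => / INR (n + 2)).
assert (Hx : forall n, 0 < x n <= / 2).
{ intros n. unfold x. rewrite plus_INR. simpl INR. assert (h := pos_INR n). split.
  - apply Rinv_0_lt_compat; lra.
  - apply Rinv_le_contravar; lra. }
set (row := fun n => - ln (1 - x n) - x n).
set (c := fun n k => RtoC (/ INR (k + 2) * x n ^ (k + 2))).
assert (Hrow : forall n, Cis_series (c n) (RtoC (row n))).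
{ intros n. specialize (Hx n). apply Cis_series_re_im. split; simpl.
  - apply ln_series. lra.
  - apply (is_series_ext (fun _ => 0)); [easy|].
    generalize (proj1 (proj1 (Cis_series_re_im (fun _ => RtoC 0) (RtoC 0))
      (Cis_series_head (fun _ => RtoC 0) (fun _ => eq_refl)))). easy. }
(* As x n <= 1/2, the sum of x^j / j over j >= 2 is at most x^2 (1 + 1/2 + 1/4 + ...) = 2 x^2. *)
assert (HM : forall n N, sum_n (fun k => Cmod (c n k)) N <= 2 * exp (- (2 * ln (INR (n + 2))))).
{ intros n N. specialize (Hx n).
  assert (e : exp (- (2 * ln (INR (n + 2)))) = x n ^ 2).
  { unfold x. rewrite <- Rpower_pow by (apply Hx).
    unfold Rpower. rewrite ln_Rinv by (rewrite plus_INR; simpl; generalize (pos_INR n); lra).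
    f_equal. simpl. ring. }
  rewrite e, Rmult_comm.
  apply Rle_trans with (sum_n (fun k => x n ^ 2 * (/ 2) ^ k) N).
  - apply sum_n_le_loc. intros k _. unfold c.
    rewrite Cmod_R, Rabs_pos_eq.
    + rewrite Nat.add_comm, pow_add.
      assert (h1 : 0 <= x n ^ k <= (/ 2) ^ k) by (split; [apply pow_le; lra | apply pow_incr; lra]).
      assert (h2 : 0 < x n ^ 2) by (apply pow_lt; lra).
      assert (h3 : 0 < / INR (2 + k) <= 1).
      { rewrite plus_INR. simpl INR. generalize (pos_INR k). intros h. split.
        - apply Rinv_0_lt_compat; lra.
        - rewrite <- Rinv_1. apply Rinv_le_contravar; lra. }
      apply Rle_trans with (1 * (x n ^ 2 * x n ^ k)).
      * apply Rmult_le_compat_r; [apply Rmult_le_pos; lra | lra].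
      * rewrite Rmult_1_l. apply Rmult_le_compat_l; lra.
    + apply Rmult_le_pos; [apply Rlt_le, Rinv_0_lt_compat, lt_0_INR; lia | apply pow_le; lra].
  - rewrite sum_n_Rscal. apply Rmult_le_compat_l; [apply pow_le; lra|].
    apply sum_n_le_is_series; [intros; apply pow_le; lra|].
    replace 2 with (/ (1 - / 2)) at 2 by field.
    apply is_series_geom. rewrite Rabs_pos_eq; lra. }
assert (HMs : ex_series (fun n => 2 * exp (- (2 * ln (INR (n + 2)))))).
{ apply (ex_series_scal_l (V := R_NormedModule)). apply ex_series_power; [lra | lia]. }
destruct (Cis_series_abs (fun n => RtoC (row n)) (Series (fun n => 2 * exp (- (2 * ln (INR (n + 2)))))))
  as (T & HT & _).
{ intros n. eapply Rle_trans; [apply sum_n_le_loc; intros k _; exact (Cis_series_Cmod_le _ _ _ (HM k) (Hrow k))|].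
  apply sum_n_le_is_series; [|now apply Series_correct].
  intros k. apply Rmult_le_pos; [lra | apply Rlt_le, exp_pos]. }
assert (Hcol : Cis_series (fun k => RtoC (/ INR (k + 2)) * dseries 2 (RtoC (INR (k + 2))))%C T).
{ apply (Cis_series_swap c _ (fun n => RtoC (row n)) _ T HM HMs Hrow); [|exact HT].
  intros k. unfold c.
  apply (Cis_series_ext (fun n => RtoC (/ INR (k + 2)) * rpw (INR (n + 2)) (RtoC (INR (k + 2))))%C).
  - intros n. rewrite rpw_INR by (apply lt_0_INR; lia). now rewrite RtoC_mult.
  - apply Cis_series_scal, dseries_correct; [lia|]. simpl Re. rewrite plus_INR. simpl.
    generalize (pos_INR k). lra. }
assert (e : C_derive hent (RtoC 1) = (- T)%C).
{ rewrite (Cis_series_unique _ _ _ Hcol hent_series_derive). ring. }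
rewrite e.
assert (Hpart : forall n, sum_n row n = ln (INR (n + 2)) - inv_sum 1 (n + 2) + 1).
{ assert (hr : forall n, row n = ln (INR (n + 2)) - ln (INR (n + 1)) - / INR (n + 2)).
  { intros n. unfold row, x. f_equal.
    assert (h := pos_INR n).
    replace (1 - / INR (n + 2)) with (INR (n + 1) / INR (n + 2))
      by (rewrite !plus_INR; simpl; field; lra).
    rewrite ln_div by (rewrite plus_INR; simpl; lra). ring. }
  induction n as [|n IH].
  - rewrite sum_O, hr. simpl (0 + 2)%nat. simpl (0 + 1)%nat. rewrite !inv_sum_S.
    unfold inv_sum. rewrite sum_n_m_zero by lia. change (@zero _) with 0.
    simpl. rewrite ln_1. lra.
  - rewrite sum_n_RS, IH, hr. replace (S n + 1)%nat with (n + 2)%nat by lia.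
    simpl (S n + 2)%nat. rewrite inv_sum_S. lra. }
apply Cis_series_re_im in HT. destruct HT as [HT1 HT2].
(* The existence of the limit defining [euler_gamma] is a by-product of the convergence of the row
   sums. *)
assert (Hlim : is_lim_seq (fun n => inv_sum 1 n - ln (INR n)) (1 - Re T)).
{ apply (is_lim_seq_incr_n _ 2). apply (is_lim_seq_ext (fun n => 1 - sum_n row n)).
  - intros n. rewrite Hpart. ring.
  - apply is_lim_seq_minus'; [apply is_lim_seq_const|]. exact HT1. }
unfold euler_gamma. rewrite (is_lim_seq_unique _ _ Hlim). simpl real.
assert (HT3 : Im T = 0).
{ rewrite <- (is_series_unique _ _ HT2). apply is_series_unique.
  generalize (proj1 (proj1 (Cis_series_re_im (fun _ => RtoC 0) (RtoC 0))
      (Cis_series_head (fun _ => RtoC 0) (fun _ => eq_refl)))). easy. }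
apply injective_projections; simpl; [unfold Re; ring|].
unfold Im in HT3. rewrite HT3. ring.
Qed.

(* The entire function (s - 1) zeta s. *)
Definition zent (s : C) : C := (hent s + (s - 1))%C.

Lemma majorized_affine (c : C) z0 r : 0 < r -> exists M, majorized (fun s => s + c)%C z0 r M (RtoC 1).
Proof.
intros Hr. exists ((Cmod (z0 + c)%C + r) * Cmod 1).
apply (majorized_ext (fun s => (s + c) * 1)%C); [intros; ring|].
replace (RtoC 1) with ((z0 + c) * 0 + 1)%C at 2 by ring.
apply (majorized_lin c (fun _ => RtoC 1)). now apply majorized_const.
Qed.

Lemma majorized_zent z0 r : 0 < r -> exists M, majorized zent z0 r M (C_derive hent z0 + 1)%C.
Proof.
intros Hr. destruct (majorized_hent z0 r Hr) as (M1 & d & H1).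
destruct (majorized_affine (- (1)) z0 r Hr) as (M2 & H2).
rewrite (majorized_C_derive _ _ _ _ _ H1).
exists (M1 + M2). exact (majorized_plus _ _ _ _ _ _ _ _ H1 H2).
Qed.

Lemma zent_1 : zent (RtoC 1) = RtoC 1.
Proof. unfold zent. rewrite hent_1. ring. Qed.

Lemma C_derive_zent_1 : C_derive zent (RtoC 1) = RtoC euler_gamma.
Proof.
destruct (majorized_zent (RtoC 1) 1 Rlt_0_1) as [M H]. rewrite (majorized_C_derive _ _ _ _ _ H).
rewrite C_derive_hent_1, RtoC_minus. ring.
Qed.

(** * The continuations of zeta and zeta_1 *)

Lemma dseries_1 s : 1 < Re s -> dseries 1 s = (1 + dseries 2 s)%C.
Proof.
intros Hs. apply CSeries_unique.
replace (1 + dseries 2 s)%C with (dseries 2 s + Csum (fun n => rpw (INR (n + 1)) s) 0)%C.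
- apply Cis_series_unshift.
  apply (Cis_series_ext (fun n => rpw (INR (n + 2)) s)); [intros n; do 2 f_equal; lia|].
  apply dseries_correct; [lia | exact Hs].
- rewrite Csum_0. unfold rpw. simpl INR. rewrite ln_1, Ropp_0, Cmult_0_r, cexp_0. ring.
Qed.

Lemma zent_dseries s : 1 < Re s -> zent s = ((s + - (1)) * dseries 1 s)%C.
Proof. intros Hs. unfold zent. rewrite hent_dseries, dseries_1 by easy. ring. Qed.

Definition zcont (s : C) : C := (zent s / (s - 1))%C.

(** The sign appears because the expansion is stated for nu - x, here nu + alpha. *)
Definition zcont1 (alpha s : C) : C := (zcont s + tsum (- alpha) zent 0 s)%C.

Lemma Cminus_neq_0 (a b : C) : a <> b -> (a - b)%C <> RtoC 0.
Proof. intros H e. now apply H, Ceq_minus. Qed.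

Lemma zcont_dseries s : 1 < Re s -> zcont s = dseries 1 s.
Proof.
intros Hs. unfold zcont. rewrite zent_dseries by easy. field.
apply Cminus_neq_0. intros e. rewrite e in Hs. simpl in Hs. lra.
Qed.

Lemma majorized_zcont z0 : z0 <> RtoC 1 ->
  exists r M d, 0 < r < Cmod (z0 - 1)%C /\ majorized zcont z0 r M d.
Proof.
intros H. assert (Hp := proj1 (Cmod_gt_0 _) (Cminus_neq_0 _ _ H)).
set (r := Cmod (z0 - 1)%C / 2) in *.
assert (Hr : 0 < r) by (unfold r; lra).
destruct (majorized_zent z0 r Hr) as [M HM].
destruct (majorized_div (RtoC 1) zent z0 r M _ ltac:(unfold r; lra) HM) as [d Hd].
exists r, (M / (Cmod (z0 - 1)%C - r)), d. split; [unfold r; lra | exact Hd].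
Qed.

Lemma majorized_zcont1_tsum alpha z0 r : Cmod alpha < 1 -> 0 < r ->
  exists (M : R) (D : C), Cis_series (fun k => dterm (- alpha) zent k z0) D /\
    majorized (tsum (- alpha) zent 0) z0 r M D.
Proof.
intros Ha Hr.
destruct (majorized_tsum (- alpha) zent 1 0 z0 r) as (M & D & HD & HM & _).
- lia.
- rewrite Cmod_opp. simpl. lra.
- exact Hr.
- exact zent_dseries.
- intros k _. destruct (majorized_zent (z0 + RtoC (INR (S k)))%C r Hr) as [M HM]. now exists M, (C_derive hent (z0 + RtoC (INR (S k))) + 1)%C.
- exists M, D. split; [|exact HM]. revert HD. apply Cis_series_ext. intros k. now rewrite Nat.add_0_r.
Qed.

Lemma is_hurwitz_zcont1 alpha : Cmod alpha < 1 -> is_hurwitz_zeta (1 + alpha)%C (zcont1 alpha).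
Proof.
intros Ha. split.
- intros s Hs.
  destruct (binomial_swap (- alpha) zent 1 s) as (T & HT & H);
    [lia | rewrite Cmod_opp; simpl; lra | lra | exact zent_dseries |].
  unfold zcont1, tsum.
  rewrite (CSeries_ext _ (fun k => term (- alpha) zent k s)) by (intros k; f_equal; lia).
  rewrite (CSeries_unique _ _ H), zcont_dseries by exact Hs.
  apply (Cis_series_ext (fun n => rpw (INR (n + 1)) s
    + (cpower (RtoC (INR (n + 1)) - - alpha) (- s) - rpw (INR (n + 1)) s))%C).
  + intros n. replace (INR n + (1 + alpha))%C with (RtoC (INR (n + 1)) - - alpha)%C
      by (rewrite plus_INR, RtoC_plus; simpl; ring).
    ring.
  + apply Cis_series_plus; [apply dseries_correct; [lia | exact Hs] | exact HT].
- intros s Hs. destruct (majorized_zcont s Hs) as (r & M & d & [Hr _] & HM).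
  destruct (majorized_zcont1_tsum alpha s r Ha Hr) as (M' & D & _ & HM').
  apply (majorized_analytic _ _ _ _ _ (majorized_plus _ _ _ _ _ _ _ _ HM HM')).
Qed.

(** * Differentiation at -m *)

Lemma is_hurwitz_zcont : is_hurwitz_zeta (RtoC 1) zcont.
Proof.
split.
- intros s Hs. rewrite zcont_dseries by exact Hs.
  apply (Cis_series_ext (fun n => rpw (INR (n + 1)) s)).
  + intros n. rewrite <- RtoC_plus, plus_INR. symmetry. apply cpower_RtoC.
    simpl. generalize (pos_INR n). lra.
  + apply dseries_correct; [lia | exact Hs].
- intros s Hs. destruct (majorized_zcont s Hs) as (r & M & d & _ & HM).
  exact (majorized_analytic _ _ _ _ _ HM).
Qed.

Lemma zeta_zcont s : s <> RtoC 1 -> zeta s = zcont s.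
Proof. apply hurwitz_zeta_unique, is_hurwitz_zcont. Qed.

Lemma disc_avoids_1 z0 z r : r < Cmod (z0 - 1)%C -> Cmod (z - z0)%C <= r -> z <> RtoC 1.
Proof.
intros Hr Hz ->. replace (1 - z0)%C with (- (z0 - 1))%C in Hz by ring.
rewrite Cmod_opp in Hz. lra.
Qed.

(** The radius is kept below the distance to 1, since [zeta] agrees with [zcont] only away from that
    point. *)
Lemma majorized_zeta z0 : z0 <> RtoC 1 ->
  exists r M, 0 < r < Cmod (z0 - 1)%C /\ majorized zeta z0 r M (zeta' z0).
Proof.
intros H. destruct (majorized_zcont z0 H) as (r & M & d & Hr & HM).
exists r, M. split; [exact Hr|].
assert (Hz : majorized zeta z0 r M d).
{ revert HM. apply majorized_ext. intros z Hz. symmetry. apply zeta_zcont.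
  apply (disc_avoids_1 z0 z r); [apply Hr | exact Hz]. }
unfold zeta'. now rewrite (majorized_C_derive _ _ _ _ _ Hz).
Qed.

Lemma zent_zeta s : s <> RtoC 1 -> zent s = ((s + - (1)) * zeta s)%C.
Proof.
intros Hs. rewrite zeta_zcont by exact Hs. unfold zcont. field. now apply Cminus_neq_0.
Qed.

Lemma C_derive_zent s : s <> RtoC 1 ->
  C_derive zent s = ((s + - (1)) * zeta' s + zeta s)%C.
Proof.
intros Hs. destruct (majorized_zeta s Hs) as (r & M & Hr & HM).
apply (majorized_lin (- (1))) in HM.
apply (majorized_C_derive zent s r _ _) with (1 := majorized_ext _ zent _ _ _ _
  (fun z Hz => eq_sym (zent_zeta z (disc_avoids_1 s z r (proj2 Hr) Hz))) HM).
Qed.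

Lemma zeta1'_series alpha s : Cmod alpha < 1 -> s <> RtoC 1 ->
  exists D : C, Cis_series (fun k => dterm (- alpha) zent k s) D /\
    zeta1' s alpha = (zeta' s + D)%C.
Proof.
intros Ha Hs. destruct (majorized_zeta s Hs) as (r & M & Hr & HM).
destruct (majorized_zcont1_tsum alpha s r Ha (proj1 Hr)) as (M' & D & HD & HM').
exists D. split; [exact HD|].
assert (H := majorized_plus _ _ _ _ _ _ _ _ HM HM').
apply (majorized_C_derive (fun t => zeta1 t alpha) s r (M + M')).
revert H. apply majorized_ext. intros z Hz.
assert (Hz1 := disc_avoids_1 s z r (proj2 Hr) Hz).
unfold zeta1. rewrite (hurwitz_zeta_unique _ _ (is_hurwitz_zcont1 alpha Ha) z Hz1).
unfold zcont1. now rewrite zeta_zcont.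
Qed.

Lemma neg_INR_neq_1 m : (- RtoC (INR m))%C <> RtoC 1.
Proof.
intros e. apply (f_equal Re) in e. simpl in e. generalize (pos_INR m). lra.
Qed.

Lemma RtoC_neq_0 (x : R) : x <> 0 -> RtoC x <> RtoC 0.
Proof. intros H e. now apply H, RtoC_inj. Qed.

(** Multiplying by (m - k)! keeps the induction free of division. *)
Lemma poch_neg m k : (k <= m)%nat ->
  (poch (- RtoC (INR m)) k * RtoC (INR (fact (m - k))) = RtoC ((-1) ^ k * INR (fact m)))%C.
Proof.
induction k as [|k IH]; intros Hk.
- rewrite Nat.sub_0_r. simpl. rewrite Rmult_1_l. ring.
- specialize (IH ltac:(lia)). replace (m - k)%nat with (S (m - S k)) in IH by lia.
  rewrite INR_fact_S, RtoC_mult in IH. simpl poch.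
  replace (- RtoC (INR m) + RtoC (INR k))%C with (- RtoC (INR (S (m - S k))))%C.
  + replace (RtoC ((-1) ^ S k * INR (fact m))) with (- RtoC ((-1) ^ k * INR (fact m)))%C
      by (rewrite <- RtoC_opp; f_equal; simpl; ring).
    rewrite <- IH. ring.
  + replace m with (S (m - S k) + k)%nat at 2 by lia. rewrite plus_INR, RtoC_plus. ring.
Qed.

Lemma inv_sum_head a b : (a <= b)%nat -> inv_sum a b = / INR a + inv_sum (S a) b.
Proof. intros H. unfold inv_sum. now rewrite sum_Sn_m by exact H. Qed.

(** Logarithmic derivative: the sum of 1 / (j - m) over j < k is minus the sum of 1 / i for i from m
    - k + 1 to m. *)
Lemma dpoch_neg_le m k : (k <= m)%nat ->
  dpoch (- RtoC (INR m)) k = (- poch (- RtoC (INR m)) k * RtoC (inv_sum (S (m - k)) m))%C.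
Proof.
induction k as [|k IH]; intros Hk.
- rewrite Nat.sub_0_r. unfold inv_sum. rewrite sum_n_m_zero by lia.
  change (RtoC 0 = - poch (- RtoC (INR m)) 0 * RtoC 0)%C. ring.
- rewrite (inv_sum_head (S (m - S k))) by lia.
  replace (S (S (m - S k))) with (S (m - k)) by lia.
  simpl dpoch. simpl poch. rewrite IH by lia.
  replace (- RtoC (INR m) + RtoC (INR k))%C with (- RtoC (INR (S (m - S k))))%C.
  + assert (h : INR (S (m - S k)) <> 0) by (apply not_0_INR; lia).
    rewrite RtoC_plus, RtoC_inv by exact h. field. now apply RtoC_neq_0.
  + replace m with (S (m - S k) + k)%nat at 2 by lia. rewrite plus_INR, RtoC_plus. ring.
Qed.

Lemma poch_neg_eq m k : (k <= m)%nat ->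
  poch (- RtoC (INR m)) k = RtoC ((-1) ^ k * INR (fact m) / INR (fact (m - k))).
Proof.
intros Hk. assert (h := INR_fact_pos (m - k)).
rewrite RtoC_div by lra. rewrite <- (poch_neg m k Hk). field. apply RtoC_neq_0; lra.
Qed.

Lemma Cpow_opp (a : C) k : ((- a) ^ k = RtoC ((-1) ^ k) * a ^ k)%C.
Proof.
rewrite RtoC_pow, <- Cpow_mult_l. f_equal. replace (RtoC (-1)) with (- (1))%C by (rewrite <- RtoC_opp; reflexivity). ring.
Qed.

Lemma pow_m1_sqr k : (-1) ^ k * (-1) ^ k = 1.
Proof. rewrite <- Rpow_mult_distr. replace (-1 * -1) with 1 by ring. apply pow1. Qed.

(** The term with [poch] drops out. What remains combines (-m)_m n! = (-1)^m m! n! with (n + 1)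
    zeta(n + 2), the value of (s - 1) zeta(s) at n + 2. *)
Lemma dterm_tail alpha m n :
  dterm (- alpha) zent (S m + n) (- RtoC (INR m)) =
    (RtoC ((-1) ^ (n + 2) * INR (fact (n + 2 - 1)) * INR (fact m) / INR (fact (m + (n + 2))))
     * zeta (RtoC (INR (n + 2))) * alpha ^ (m + (n + 2)))%C.
Proof.
unfold dterm. rewrite poch_neg_zero, dpoch_neg, poch_neg_eq, Nat.sub_diag by lia.
replace (- RtoC (INR m) + RtoC (INR (S (S m + n))))%C with (RtoC (INR (n + 2))).
2: { replace (S (S m + n)) with (m + (n + 2))%nat by lia.
     rewrite (plus_INR m), RtoC_plus. ring. }
rewrite zent_zeta.
2: { intros e. apply RtoC_inj in e. rewrite plus_INR in e. simpl in e. generalize (pos_INR n). lra. }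
replace (S (S m + n)) with (m + (n + 2))%nat by lia.
rewrite Cpow_opp.
replace (n + 2 - 1)%nat with (S n) by lia. rewrite INR_fact_S.
replace (RtoC (INR (n + 2)) + - (1))%C with (RtoC (INR (S n)))
  by (rewrite Nat.add_comm; simpl (2 + n)%nat; rewrite (S_INR (S n)), RtoC_plus; ring).
assert (h := INR_fact_pos (m + (n + 2))).
replace (RtoC ((-1) ^ (n + 2) * (INR (S n) * INR (fact n)) * INR (fact m) / INR (fact (m + (n + 2)))))
  with (RtoC ((-1) ^ (m + (n + 2)) * / INR (fact (m + (n + 2))) *
     ((-1) ^ m * INR (fact m) / INR (fact 0) * INR (fact n)) * INR (S n))).
- rewrite !RtoC_mult. ring.
- f_equal. rewrite pow_add. simpl (INR (fact 0)).
  replace ((-1) ^ m * (-1) ^ (n + 2) * / INR (fact (m + (n + 2))) *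
    ((-1) ^ m * INR (fact m) / 1 * INR (fact n)) * INR (S n))
  with ((-1) ^ m * (-1) ^ m * ((-1) ^ (n + 2) * / INR (fact (m + (n + 2))) * (INR (fact m) * INR (fact n)) * INR (S n)))
    by (field; lra).
  rewrite pow_m1_sqr. field. lra.
Qed.

(** Here the argument -m + m + 1 is the former pole, where (s - 1) zeta(s) has value 1 and
    derivative gamma; the signs (-1)^(m+1) and (-1)^m leave H_m - gamma. *)
Lemma dterm_diag alpha m :
  dterm (- alpha) zent m (- RtoC (INR m)) =
    (alpha ^ (m + 1) / RtoC (INR (m + 1)) * RtoC (inv_sum 1 m - euler_gamma))%C.
Proof.
unfold dterm. rewrite dpoch_neg_le, poch_neg_eq, Nat.sub_diag by lia.
replace (- RtoC (INR m) + RtoC (INR (S m)))%C with (RtoC 1)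
  by (rewrite S_INR, RtoC_plus; ring).
rewrite C_derive_zent_1, zent_1, Cpow_opp, INR_fact_S, Nat.add_1_r.
assert (h := INR_fact_pos m). assert (h2 : INR (S m) <> 0) by (apply not_0_INR; lia).
replace (RtoC (/ (INR (S m) * INR (fact m)))) with (/ RtoC (INR (S m)) * / RtoC (INR (fact m)))%C
  by (rewrite Rinv_mult, RtoC_mult, !RtoC_inv by (exact h2 || lra); reflexivity).
simpl (INR (fact 0)). unfold Rdiv. rewrite Rinv_1, Rmult_1_r, RtoC_mult, RtoC_minus.
replace (RtoC ((-1) ^ S m)) with (- RtoC ((-1) ^ m))%C by (rewrite <- RtoC_opp; f_equal; simpl; ring).
assert (e : (RtoC ((-1) ^ m) * RtoC ((-1) ^ m) = 1)%C) by (rewrite <- RtoC_mult; f_equal; apply pow_m1_sqr).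
set (u := RtoC ((-1) ^ m)) in *. set (f := RtoC (INR (fact m))).
assert (hf : f <> RtoC 0) by (apply RtoC_neq_0; lra).
assert (hS : RtoC (INR (S m)) <> RtoC 0) by now apply RtoC_neq_0.
transitivity ((u * u) * (alpha ^ S m / RtoC (INR (S m)) * (RtoC (inv_sum 1 m) - RtoC euler_gamma)))%C.
- field. split; assumption.
- rewrite e. ring.
Qed.

(** The derivative of (s - 1) zeta(s) at -k is -(k + 1) zeta'(-k) + zeta(-k). After -(k + 1) is
    factored out, the stray zeta(-k) supplies the summand j = k + 1 missing from the harmonic sum,
    and k + 1 turns m! / ((k + 1)! (m - k)!) into the binomial coefficient. *)
Lemma dterm_head alpha m k : (k < m)%nat ->
  dterm (- alpha) zent (m - 1 - k) (- RtoC (INR m)) =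
    (alpha ^ (m - k) * RtoC (Binomial.C m k)
      * (zeta' (- RtoC (INR k)) - zeta (- RtoC (INR k)) * RtoC (inv_sum (k + 1) m)))%C.
Proof.
intros Hk. unfold dterm. rewrite dpoch_neg_le, poch_neg_eq by lia.
replace (m - (m - 1 - k))%nat with (S k) by lia.
replace (S (m - 1 - k)) with (m - k)%nat by lia.
replace (- RtoC (INR m) + RtoC (INR (m - k)))%C with (- RtoC (INR k))%C
  by (rewrite minus_INR, RtoC_minus by lia; ring).
rewrite C_derive_zent, zent_zeta by apply neg_INR_neq_1.
rewrite Nat.add_1_r, (inv_sum_head (S k)) by lia.
unfold Binomial.C. rewrite INR_fact_S, Cpow_opp.
set (zp := zeta' (- RtoC (INR k))). set (z := zeta (- RtoC (INR k))).
set (i := inv_sum (S (S k)) m).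
assert (h1 := INR_fact_pos k). assert (h2 := INR_fact_pos (m - k)).
assert (h3 : INR (S k) <> 0) by (apply not_0_INR; lia).
replace (- RtoC (INR k) + - (1))%C with (- RtoC (INR (S k)))%C by (rewrite S_INR, RtoC_plus; ring).
assert (e : (-1) ^ (m - k) * (-1) ^ (m - 1 - k) = -1).
{ replace (m - k)%nat with (S (m - 1 - k)) by lia.
  replace ((-1) ^ S (m - 1 - k) * (-1) ^ (m - 1 - k)) with (- ((-1) ^ (m - 1 - k) * (-1) ^ (m - 1 - k)))
    by (simpl; ring). rewrite pow_m1_sqr. ring. }
apply (f_equal RtoC) in e. rewrite RtoC_mult in e.
unfold Rdiv. rewrite !RtoC_mult, RtoC_plus, !Rinv_mult, !RtoC_mult, !RtoC_inv by (exact h3 || lra).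
set (u := RtoC ((-1) ^ (m - k))) in *. set (v := RtoC ((-1) ^ (m - 1 - k))) in *.
assert (hc1 : RtoC (INR (fact k)) <> RtoC 0) by (apply RtoC_neq_0; lra).
assert (hc2 : RtoC (INR (fact (m - k))) <> RtoC 0) by (apply RtoC_neq_0; lra).
assert (hc3 : RtoC (INR (S k)) <> RtoC 0) by now apply RtoC_neq_0.
(* The signs u and v have product -1, so the right-hand side is multiplied by 1 in a form that
   [field] can match. *)
match goal with |- _ = ?rhs => transitivity (- (u * v) * rhs)%C end.
- field. repeat split; assumption.
- rewrite e. replace (RtoC (-1)) with (- (1))%C by (rewrite <- RtoC_opp; reflexivity). ring.
Qed.

(** * Assembling the formula *)

Lemma Csum_rev (f : nat -> C) n : Csum (fun k => f (n - k)%nat) n = Csum f n.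
Proof.
revert f. induction n as [|n IH]; intros f; [now rewrite !Csum_0|].
rewrite (Csum_S f), <- IH.
unfold sum_n. rewrite sum_Sn_m by lia. rewrite <- sum_n_m_S.
change (f (S n) + Csum (fun k => f (S n - S k)%nat) n
  = Csum (fun k => f (n - k)%nat) n + f (S n))%C.
rewrite Cplus_comm. f_equal.
Qed.

(** The expansion index j of a head term corresponds to k = m - 1 - j in the formula, so the head is
    summed in reverse. *)
Lemma Csum_Csum_lt (f g : nat -> C) m :
  (forall k, (k < m)%nat -> f (m - 1 - k)%nat = g k) ->
  Csum f m = (Csum_lt m g + f m)%C.
Proof.
intros H. destruct m as [|m]; [rewrite Csum_0; simpl; ring|].
rewrite Csum_S. f_equal. simpl. rewrite <- Csum_rev.
apply (sum_n_ext_loc (G := C_AbelianMonoid)). intros k Hk.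
rewrite <- H by lia. f_equal. lia.
Qed.

Theorem theorem3 : forall (alpha : C) (m : nat),
  Cmod alpha < 1 ->
  exists tail : C,
    @is_series C_AbsRing C_NormedModule
      (fun n : nat =>
         let k := (n + 2)%nat in
         (RtoC ((-1) ^ k * INR (fact (k - 1)) * INR (fact m)
                / INR (fact (m + k)))
          * zeta (INR k) * alpha ^ (m + k))%C)
      tail /\
    zeta1' (- INR m)%C alpha =
      (zeta' (- INR m)
       + Csum_lt m (fun k : nat =>
           alpha ^ (m - k) * RtoC (Binomial.C m k)
           * (zeta' (- INR k) - zeta (- INR k) * RtoC (inv_sum (k + 1) m)))
       + alpha ^ (m + 1) / RtoC (INR (m + 1))
         * RtoC (inv_sum 1 m - euler_gamma)
       + tail)%C.
Proof.
intros alpha m Ha.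
destruct (zeta1'_series alpha (- RtoC (INR m)) Ha (neg_INR_neq_1 m)) as (D & HD & HZ).
(* The m + 1 terms taken off are the m head terms and the diagonal one. *)
exists (D - Csum (fun k => dterm (- alpha) zent k (- RtoC (INR m))) m)%C. split.
- apply (Cis_series_ext (fun n => dterm (- alpha) zent (S m + n) (- RtoC (INR m)))).
  + intros n. apply dterm_tail.
  + exact (Cis_series_shift _ _ m HD).
- rewrite HZ.
  rewrite (Csum_Csum_lt _ _ m (fun k Hk => dterm_head alpha m k Hk)), dterm_diag.
  ring.
Qed.
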